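(* Let $k\ge1$, fix $(\gamma_0,\gamma_1)\in\Gamma^k_{\mathrm{sub}}$ and let $r_1<r_m<r_2$ denote the three distinct real roots (each of multiplicity one) of $\Delta_k$ in $\mathcal{S}=[\gamma_1,1-\gamma_0]$. Then: (i) $t^n_{\mathrm{mix}}=\Omega(\exp(\Theta(n)))$. (ii) For any constant $p\in\mathcal{S}$ with $p\ne r_m$ and any sufficiently small $\delta,\epsilon>0$, we have $$\mathbb{P}_p\left(T^n_{\mathrm{enter}}(B_\delta(r^* ))>\frac{C\log n}{\epsilon}\right)\le\epsilon$$ for some positive constant $C$ (independent of $n$) and for all sufficiently large $n$, where $r^*=r_1$ if $p<r_m$ and $r^*=r_2$ if $p>r_m$. (iii) For any $i\in\{1,2\}$ and any sufficiently small $\delta>0$, we have $T^n_{\mathrm{exit}}(B_\delta(r_i))=\Omega(\exp(\Theta(n)))$ with high probability, for any starting state $X^n(0)\in B_{\delta/2}(r_i)$.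
   Context: Fix an integer $k\ge1$ (independent of $n$) and parameters $(\gamma_0,\gamma_1)\in\Gamma:=\{(\gamma_0,\gamma_1)\in(0,1)^2: 0<\gamma_0+\gamma_1<1\}$. Write $\mathcal{S}=[\gamma_1,1-\gamma_0]$ and let $P_k$ be the polynomial $P_k(x)=\sum_{r=k+1}^{2k}\binom{2k}{r}x^r(1-x)^{2k-r}$. The $2k$-choices model with stubborn agents: there are $n$ agents (complete network), with $N_i^n=\lceil n\gamma_i\rceil$ agents stubbornly holding opinion $i\in\{0,1\}$ forever; each other agent updates at the points of an independent unit-rate Poisson process by sampling $2k$ of the other $n-1$ agents uniformly at random with replacement and adopting the majority opinion among the sampled agents and itself. $X^n(t)$ is the proportion of agents holding opinion $1$ at time $t\ge0$. Equivalently (for $n$ large enough that the state space is nonempty), $X^n$ is the continuous-time birth-death Markov chain on $\mathcal{S}^n=\{N_1^n/n,(N_1^n+1)/n,\ldots,1-N_0^n/n\}$ jumping from $x$ to $x+1/n$ at rate $q^n_+(x)=n\left(1-x-\frac{N_0^n}{n}\right)P_k(b_nx)$ and from $x$ to $x-1/n$ at rate $q^n_-(x)=n\left(x-\frac{N_1^n}{n}\right)P_k(b_n(1-x))$, where $b_n=n/(n-1)$. It is ergodic with unique stationary distribution $\pi^n$. The limiting drift is the polynomial $\Delta_k(x)=(1-x-\gamma_0)P_k(x)-(x-\gamma_1)P_k(1-x)$. $\Gamma^k_{\mathrm{sub}}$ is the set of $(\gamma_0,\gamma_1)\in\Gamma$ for which $\Delta_k$ has exactly three distinct real roots (each of multiplicity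 one) in $\mathcal{S}$. Notation: $B_\delta(p)=(p-\delta,p+\delta)$; $T^n_{\mathrm{exit}}(B)=\inf\{t\ge0:X^n(t)\notin B\}$; $T^n_{\mathrm{enter}}(B)=\inf\{t\ge0:X^n(t)\in B\}$; $\mathbb{P}_p$ is the probability conditioned on $X^n(0)=\lceil np\rceil/n$ (on $X^n(0)=1-N_0^n/n$ if $\lceil np\rceil/n$ exceeds the largest state $1-N_0^n/n$). $d^n(t)=\max_{x\in\mathcal{S}^n}\max_{A\subseteq\mathcal{S}^n}|\mathbb{P}_x(X^n(t)\in A)-\pi^n(A)|$ and $t^n_{\mathrm{mix}}=\inf\{t:d^n(t)\le1/4\}$. $f(n)=\Omega(g(n))$ means $\limsup_{n\to\infty} g(n)/f(n)<\infty$; a quantity is $\Omega(\exp(\Theta(n)))$ if it is $\Omega(\exp(cn))$ for some constant $c>0$ independent of $n$. An event occurs with high probability if its probability converges to one as $n\to\infty$; thus (iii) means that for some constants $c,c'>0$ independent of $n$, the probability that $T^n_{\mathrm{exit}}(B_\delta(r_i))\ge c'\exp(cn)$ tends to $1$ as $n\to\infty$. *)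

(* Defs.v *)
From HB Require Import structures.
From mathcomp Require Import all_boot all_order all_algebra.
From mathcomp Require Import all_classical all_reals all_analysis.
Set Implicit Arguments.
Unset Strict Implicit.
Unset Printing Implicit Defensive.
Import Order.TTheory GRing.Theory Num.Theory.
Import numFieldNormedType.Exports.
Local Open Scope classical_set_scope.
Local Open Scope ring_scope.

Definition majority_poly (R : realType) (k : nat) : {poly R} :=
  \sum_(k.+1 <= r < (2 * k).+1)
    'C(2 * k, r)%:R *: ('X^r * (1 - 'X) ^+ (2 * k - r)).

Definition drift (R : realType) (k : nat) (g0 g1 : R) : {poly R} :=
  (1 - 'X - g0%:P) * majority_poly R k
  - ('X - g1%:P) * (majority_poly R k \Po (1 - 'X)).

Definition Gamma (R : realType) (g0 g1 : R) : Prop :=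
  [/\ 0 < g0 < 1, 0 < g1 < 1 & 0 < g0 + g1 < 1].

Definition Sspace (R : realType) (g0 g1 : R) : set R :=
  [set x | g1 <= x <= 1 - g0].

(* [s] lists, without repetition, all the roots of the drift in [Sspace]. *)
Definition drift_roots (R : realType) (k : nat) (g0 g1 : R) (s : seq R) : Prop :=
  uniq s /\
  forall x, x \in s <-> (Sspace g0 g1 x /\ root (drift k g0 g1) x).

Definition Gamma_sub (R : realType) (k : nat) (g0 g1 : R) : Prop :=
  Gamma g0 g1 /\
  exists s : seq R,
    [/\ size s = 3%N, drift_roots k g0 g1 s &
        forall x, x \in s -> mup x (drift k g0 g1) = 1%N].

(* [Pr x] is the law under which the chain starts at [x].  The last two fields
   are the (simple, time-homogeneous) Markov property, tested against arbitrary
   finite histories up to time [u], and the jump rates [q x y] for [x != y];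
   the values [q x x] are irrelevant. *)
Record is_markov_chain (R : realType) (T : finType) (q : T -> T -> R)
    (d : measure_display) (Omega : measurableType d)
    (Pr : T -> probability Omega R) (X : R -> Omega -> T) : Prop :=
  IsMarkovChain {
    chain_measurable : forall t y, 0 <= t -> measurable [set w | X t w = y];
    chain_right_continuous : forall w t, 0 <= t ->
      exists2 h : R, 0 < h & forall s, t <= s < t + h -> X s w = X t w;
    chain_start : forall x, Pr x [set w | X 0 w = x] = 1%E;
    chain_markov : forall (x : T) (hist : seq (R * T)) (u s : R) (y z : T),
      0 <= s -> 0 <= u -> (forall e, e \in hist -> 0 <= e.1 <= u) ->
      let past :=
        [set w | (forall e, e \in hist -> X e.1 w = e.2) /\ X u w = y] in
      Pr x (past `&` [set w | X (u + s) w = z])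
        = (Pr x past * Pr y [set w | X s w = z])%E;
    chain_rates : forall x y, x != y ->
      fine (Pr x [set w | X h w = y]) / h @[h --> 0^'+] --> q x y }.

Definition stationary (R : realType) (T : finType)
    (d : measure_display) (Omega : measurableType d)
    (Pr : T -> probability Omega R) (X : R -> Omega -> T) (mu : T -> R) : Prop :=
  [/\ forall y, 0 <= mu y, \sum_y mu y = 1 &
      forall t y, 0 <= t ->
        \sum_x mu x * fine (Pr x [set w | X t w = y]) = mu y].

Definition tv_distance (R : realType) (T : finType)
    (d : measure_display) (Omega : measurableType d)
    (Pr : T -> probability Omega R) (X : R -> Omega -> T) (mu : T -> R)
    (t : R) : R :=
  \big[Num.max/0]_(x : T) \big[Num.max/0]_(A : {set T})
    `|fine (Pr x [set w | X t w \in A]) - \sum_(y in A) mu y|.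

Definition mixing_time (R : realType) (T : finType)
    (d : measure_display) (Omega : measurableType d)
    (Pr : T -> probability Omega R) (X : R -> Omega -> T) (mu : T -> R) : \bar R :=
  ereal_inf [set t%:E | t in [set t | 0 <= t /\ tv_distance Pr X mu t <= 1 / 4]].

Definition stubborn (R : realType) (n : nat) (g : R) : nat :=
  `|Num.ceil (n%:R * g)|%N.

Definition nonempty_states (R : realType) (g0 g1 : R) (n : nat) : Prop :=
  (stubborn n g0 + stubborn n g1 <= n)%N.

(* The state [j] has [stubborn n g1 + j] agents of opinion 1.  If the stubborn
   agents outnumber [n] the true state space is empty and this type is a junk
   singleton; for [g0 + g1 < 1] that concerns finitely many [n] only. *)
Definition state (R : realType) (g0 g1 : R) (n : nat) : finType :=
  'I_(n - stubborn n g0 - stubborn n g1).+1.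

Definition prop1 (R : realType) (g0 g1 : R) (n : nat) (j : state g0 g1 n) : R :=
  (stubborn n g1 + nat_of_ord j)%:R / n%:R.

(* The state with [min(ceil(n p), n - stubborn n g0)] agents of opinion 1;
   [inord] is not truncating when [p] is in [Sspace g0 g1] and
   [nonempty_states g0 g1 n] holds. *)
Definition start_state (R : realType) (g0 g1 : R) (n : nat) (p : R) :
    state g0 g1 n :=
  inord (minn `|Num.ceil (n%:R * p)|%N (n - stubborn n g0) - stubborn n g1).

Definition resampling (R : realType) (n : nat) : R := n%:R / (n%:R - 1).

Definition rate_up (R : realType) (k : nat) (g0 : R) (n : nat) (x : R) : R :=
  n%:R * (1 - x - (stubborn n g0)%:R / n%:R)
  * (majority_poly R k).[resampling R n * x].

Definition rate_down (R : realType) (k : nat) (g1 : R) (n : nat) (x : R) : R :=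
  n%:R * (x - (stubborn n g1)%:R / n%:R)
  * (majority_poly R k).[resampling R n * (1 - x)].

Definition jump_rate (R : realType) (k : nat) (g0 g1 : R) (n : nat)
    (i j : state g0 g1 n) : R :=
  if nat_of_ord j == (nat_of_ord i).+1 then rate_up k g0 n (prop1 i)
  else if nat_of_ord i == (nat_of_ord j).+1 then rate_down k g1 n (prop1 i)
  else 0.

(* [+oo] if the path never visits [A]. *)
Definition T_enter (R : realType) (path : R -> R) (A : set R) : \bar R :=
  ereal_inf [set t%:E | t in [set t | 0 <= t /\ A (path t)]].

Definition T_exit (R : realType) (path : R -> R) (A : set R) : \bar R :=
  ereal_inf [set t%:E | t in [set t | 0 <= t /\ ~ A (path t)]].

(* [f = Omega(g)].  In [\bar R] one has [0^-1 = +oo] and [+oo^-1 = 0], so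
   values [f n = 0] make the ratio infinite, not zero. *)
Definition bigOmega (R : realType) (f : nat -> \bar R) (g : nat -> R) : Prop :=
  (limn_esup (fun n => (g n)%:E / f n) < +oo)%E.

Definition exponentially_large (R : realType) (f : nat -> \bar R) : Prop :=
  exists2 c : R, 0 < c & bigOmega f (fun n => expR (c * n%:R)).

(* Main.v *)
Require Import Defs.
From HB Require Import structures.
From mathcomp Require Import all_boot all_order all_algebra.
From mathcomp Require Import all_classical all_reals all_analysis.
From mathcomp Require Import ring lra zify.
Set Implicit Arguments.
Unset Strict Implicit.
Unset Printing Implicit Defensive.
Import Order.TTheory GRing.Theory Num.Theory.
Import numFieldNormedType.Exports.
Local Open Scope classical_set_scope.
Local Open Scope ring_scope.

(** The chain is a small random perturbation of the flow of the drift, whose two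
outer zeros are stable and whose middle zero is unstable. All three claims
follow from two Lyapunov estimates for a finite continuous-time chain. Let [V]
be a nonnegative function of the state and [L] the generator.
- If [V >= 1] outside [A] and [L V < kappa] on [A], then the chain started at
  [x] stays in [A] up to time [t] with probability at least
  [1 - V x - kappa t] ([stays_upto_ge]).
- If at each state of [A] either [V >= 1] or [L V < - kappa], and
  [kappa t <= 1], then the chain stays in [A] up to time [t] with probability at
  most [V x + 1 - kappa t] ([stays_upto_le]).

Both are first shown for the skeleton observed at multiples of a time step [h],
where the Markov property gives the survival probability as an iterate of a
killed transition operator and induction applies. Letting [h] tend to zero
through dyadic fractions of [t] only requires the derivatives of the transition
probabilities at zero and right-continuity of the paths; no construction of the
process from its jumps is needed.

For the model, the rates are [n a] and [n b] with [a - b] within order [1/n] of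
the drift ([rates_drift]). The drift is the cubic with the given zeros times a
cofactor that is negative on the state space, which yields its sign and a lower bound on
its size away from the zeros ([drift_sign]). Let [s] be plus or minus one and
[m > 0]. If [alpha] is small compared with [m] and [n] is large, the exponential
[expR (alpha n (s x - c))] has nonpositive generator wherever [s] times the drift
is at most [- m], and everywhere its generator is at most of order [n] times
itself.

Metastability ([metastable]) follows by taking for [V] the sum of the two
exponentials with thresholds at the ends of the ball: at each point of the ball,
each of them is exponentially small or decreases on average. For
the entrance time ([entrance]), [V] is the sum of an exponential that blocks the
return to the unstable zero and of a small multiple of the distance to the well,
which decreases at a positive rate; this bounds the entrance time independently
of [n], which is stronger than the logarithmic bound. For the mixing time, the
balls around the two wells are disjoint, so one of them has stationary mass at
most one half, and the chain started in that one remains there for an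
exponentially long time ([mixing_time_ge]). *)

(** * The skeleton of a finite Markov chain *)

Lemma fine_probability_partition (R : realType) (T : finType)
    (d : measure_display) (Omega : measurableType d) (P : probability Omega R)
    (Y : Omega -> T) (E : set Omega) :
    (forall y, measurable [set w | Y w = y]) -> measurable E ->
  fine (P E) = \sum_y fine (P (E `&` [set w | Y w = y])).
Proof.
move=> mY mE.
have mEY y : measurable (E `&` [set w | Y w = y]) by exact: measurableI.
have EE : E = \bigcup_(y in [set` enum T]) (E `&` [set w | Y w = y]).
  apply/seteqP; split => [w Ew|w [y _ []//]].
  by exists (Y w) => //=; rewrite mem_enum.
rewrite [in LHS]EE measure_fin_bigcup//; last first.
  by move=> y z _ _ [w [[_ /= <-] [_ /= <-]]].
rewrite -fsbig_seq ?enum_uniq// -sum_fine; last first.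
  by move=> y _; rewrite fin_num_measure.
by rewrite big_enum.
Qed.

Section FiniteChain.
Context (R : realType) (T : finType) (q : T -> T -> R)
  (d : measure_display) (Omega : measurableType d)
  (Pr : T -> probability Omega R) (X : R -> Omega -> T).
Hypothesis HX : is_markov_chain q Pr X.

Implicit Types (x y z : T) (A : {set T}) (f : T -> R).

(** The probability of being at [y] at time [h] when started at [x]. *)
Definition transition (h : R) (x y : T) : R := fine (Pr x [set w | X h w = y]).

(** The generator of the jump rates [q]; the diagonal rates play no role. *)
Definition generator (f : T -> R) (x : T) : R :=
  \sum_(y | y != x) q x y * (f y - f x).

(** The event that the path is in [A] at all the listed times. *)
Definition stays_at (ts : seq R) (A : {set T}) : set Omega :=
  [set w | forall t, t \in ts -> X t w \in A].

Lemma transition_ge0 h x y : 0 <= transition h x y.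
Proof. exact: fine_ge0. Qed.

Lemma measurable_mem t A : 0 <= t -> measurable [set w | X t w \in A].
Proof.
move=> t0.
have -> : [set w | X t w \in A] = \bigcup_(y in [set` A]) [set w | X t w = y].
  by apply/seteqP; split => [w Aw|w [y /= yA ->]]; [exists (X t w)|].
apply: fin_bigcup_measurable; first exact: finite_finset.
by move=> y _; exact: (chain_measurable HX).
Qed.

Lemma measurable_stays_at ts A : (forall t, t \in ts -> 0 <= t) ->
  measurable (stays_at ts A).
Proof.
elim: ts => [_|t ts IH ts0].
  by rewrite (_ : stays_at _ _ = setT)//; apply/seteqP; split.
have -> : stays_at (t :: ts) A = [set w | X t w \in A] `&` stays_at ts A.
  apply/seteqP; split => [w H|w [H1 H2] s].
    by split => [|s sts]; apply: H; rewrite inE ?eqxx// sts orbT.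
  by rewrite inE => /orP[/eqP ->//|/H2].
apply: measurableI; first by apply: measurable_mem; apply: ts0; rewrite inE eqxx.
by apply: IH => s sts; apply: ts0; rewrite inE sts orbT.
Qed.

Lemma measurable_history (hist : seq (R * T)) :
    (forall e, e \in hist -> 0 <= e.1) ->
  measurable [set w | forall e, e \in hist -> X e.1 w = e.2].
Proof.
elim: hist => [_|e es IH es0].
  by rewrite (_ : mkset _ = setT)//; apply/seteqP; split.
have -> : [set w | forall a, a \in e :: es -> X a.1 w = a.2] =
    [set w | X e.1 w = e.2] `&` [set w | forall a, a \in es -> X a.1 w = a.2].
  apply/seteqP; split => [w H|w [H1 H2] s].
    by split => [|s sts]; apply: H; rewrite inE ?eqxx// sts orbT.
  by rewrite inE => /orP[/eqP ->//|/H2].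
apply: measurableI.
  by apply: (chain_measurable HX); apply: es0; rewrite inE eqxx.
by apply: IH => s sts; apply: es0; rewrite inE sts orbT.
Qed.

Lemma sum_transition h x : 0 <= h -> \sum_y transition h x y = 1.
Proof.
move=> h0; rewrite -[RHS](_ : fine (Pr x setT) = 1); last by rewrite probability_setT.
rewrite (@fine_probability_partition _ _ _ _ (Pr x) (X h))//.
  by apply: eq_bigr => y _; rewrite setTI.
by move=> y; exact: (chain_measurable HX).
Qed.

(** The Markov property for a history that only records membership in a set
of states. *)
Lemma markov_stays_at ts A (hist : seq (R * T)) (u s : R) x y z :
    0 <= s -> 0 <= u -> (forall e, e \in hist -> 0 <= e.1 <= u) ->
    (forall t, t \in ts -> 0 <= t <= u) ->
  let past := [set w | forall e, e \in hist -> X e.1 w = e.2] `&`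
              stays_at ts A `&` [set w | X u w = y] in
  fine (Pr x (past `&` [set w | X (u + s) w = z])) =
  fine (Pr x past) * transition s y z.
Proof.
move=> s0 u0; elim: ts hist => [|t ts IH] hist hist0 ts0 /=.
  have -> : [set w | forall e, e \in hist -> X e.1 w = e.2] `&`
      stays_at [::] A `&` [set w | X u w = y] =
      [set w | (forall e, e \in hist -> X e.1 w = e.2) /\ X u w = y].
    by apply/seteqP; split => w /=; [case => -[]//|case].
  rewrite (chain_markov HX)// fineM// fin_num_measure//.
    rewrite (_ : mkset _ = [set w | forall e, e \in hist -> X e.1 w = e.2] `&`
      [set w | X u w = y])//; apply: measurableI.
      by apply: measurable_history => e /hist0 /andP[].
    exact: (chain_measurable HX).
  exact: (chain_measurable HX).
have t0 : 0 <= t by have /andP[] := ts0 t (mem_head _ _).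
have ts0' s' : s' \in ts -> 0 <= s' <= u.
  by move=> H; apply: ts0; rewrite inE H orbT.
set F := fun G : set Omega => fine (Pr x G).
set past := _ `&` [set w | X u w = y].
have mpast : measurable past.
  apply: measurableI; last exact: (chain_measurable HX).
  apply: measurableI; last by apply: measurable_stays_at => s' /ts0 /andP[].
  by apply: measurable_history => e /hist0 /andP[].
have mXt a : measurable [set w | X t w = a] by exact: (chain_measurable HX).
have mfut : measurable (past `&` [set w | X (u + s) w = z]).
  by apply: measurableI => //; apply: (chain_measurable HX); rewrite addr_ge0.
rewrite (fine_probability_partition (Pr x) mXt mfut).
rewrite (fine_probability_partition (Pr x) mXt mpast) mulr_suml.
apply: eq_bigr => a _.
have [aA|aA] := boolP (a \in A); last first.
  have E0 : past `&` [set w | X t w = a] = set0.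
    rewrite -subset0 => w [[[_ H] _] /= E]; move/negP: aA; apply.
    by rewrite -E; apply: H; rewrite mem_head.
  by rewrite setIAC E0 set0I measure0 /= mul0r.
have E1 : past `&` [set w | X t w = a] =
    [set w | forall e, e \in (t, a) :: hist -> X e.1 w = e.2] `&`
              stays_at ts A `&` [set w | X u w = y].
  apply/seteqP; split => w.
    case=> -[[H1 H2] H3] H4; split=> //; split=> [e|t' t'ts].
      by rewrite inE => /orP[/eqP ->//|]; exact: H1.
    by apply: H2; rewrite inE t'ts orbT.
  case=> -[H1 H2] H3; have H4 : X t w = a by have := H1 _ (mem_head _ _).
  split=> //; split=> //; split=> [e ehist|t'].
    by apply: H1; rewrite inE ehist orbT.
  by rewrite inE => /orP[/eqP ->|]; [rewrite H4|exact: H2].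
rewrite setIAC E1 IH//.
move=> e; rewrite inE => /orP[/eqP -> /=|]; last exact: hist0.
by apply: ts0; rewrite mem_head.
Qed.

(** The times [0, h, ..., N h]. *)
Definition grid (h : R) (N : nat) : seq R := [seq i%:R * h | i <- iota 0 N.+1].

(** One step of the discrete skeleton killed outside [A]. *)
Definition killed_step (h : R) (A : {set T}) (f : T -> R) (x : T) : R :=
  (x \in A)%:R * \sum_y transition h x y * f y.

(** The probability of staying in [A] at the times [0, h, ..., N h]. *)
Definition survival (h : R) (A : {set T}) (N : nat) : T -> R :=
  iter N (killed_step h A) (fun x => (x \in A)%:R).

Lemma grid_ge0 h N t : 0 <= h -> t \in grid h N -> 0 <= t.
Proof. by move=> h0 /mapP[i _ ->]; rewrite mulr_ge0. Qed.

Lemma stays_at_gridS h N A :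
  stays_at (grid h N.+1) A =
  stays_at (grid h N) A `&` [set w | X (N.+1%:R * h) w \in A].
Proof.
have E : grid h N.+1 = grid h N ++ [:: N.+1%:R * h].
  by rewrite /grid -(addn1 N.+1) iotaD map_cat.
apply/seteqP; split => w.
  move=> H; split=> [t tg|]; apply: H; rewrite E mem_cat ?tg//.
  by rewrite mem_head orbT.
move=> [H1 H2] t; rewrite E mem_cat => /orP[/H1//|].
by rewrite inE => /eqP ->.
Qed.

Lemma Pr_start x y : fine (Pr x [set w | X 0 w = y]) = (x == y)%:R.
Proof.
have [<-|xy] := eqVneq x y; first by rewrite (chain_start HX).
have := @sum_transition 0 x (lexx 0).
rewrite (bigD1 x)//= {1}/transition (chain_start HX)/= => /eqP.
rewrite -subr_eq0 addrAC subrr add0r psumr_eq0; last first.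
  by move=> ? _; exact: transition_ge0.
move=> /allP /(_ y); rewrite mem_index_enum => /(_ isT).
by rewrite eq_sym xy /= => /eqP.
Qed.

(** The mean of [f] at time [N h] on the event of staying in [A] at all grid
times is an iterate of the killed transition operator: the last step of the
path becomes the innermost application of the operator. *)
Lemma sum_stays_at_grid h N A f x : 0 <= h ->
  \sum_y fine (Pr x (stays_at (grid h N) A `&` [set w | X (N%:R * h) w = y])) * f y
  = iter N (killed_step h A) (fun y => (y \in A)%:R * f y) x.
Proof.
move=> h0; elim: N f => [|N IH] f.
  have z0 : 0%:R * h = 0 by rewrite mul0r.
  rewrite z0 /= (bigD1 x)//= big1 ?addr0 => [|y yx]; last first.
    rewrite (_ : fine _ = 0) ?mul0r//.
    apply/eqP; rewrite eq_le fine_ge0// andbT.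
    rewrite -[leRHS](_ : fine (Pr x [set w | X 0 w = y]) = 0); last first.
      by rewrite Pr_start eq_sym (negbTE yx).
    have mX0 : measurable [set w | X 0 w = y] by exact: (chain_measurable HX).
    have mI : measurable
       (stays_at (grid h 0) A `&` [set w | X 0 w = y]).
      apply: measurableI => //.
      by apply: measurable_stays_at => t; exact: grid_ge0.
    apply: fine_le; rewrite ?fin_num_measure//.
    by apply: le_measure; rewrite ?inE// => w [].
  congr (_ * _).
  rewrite (_ : stays_at _ _ `&` _ =
      if x \in A then [set w | X 0 w = x] else set0).
    case: ifP => _; first by rewrite (chain_start HX).
    by rewrite measure0.
  apply/seteqP; split => w.
    by move=> [/(_ 0) H /= E]; rewrite -{1}E H ?inE ?z0.
  case: ifP => // xA /= E; split=> // t; rewrite inE => /eqP ->.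
  by rewrite z0 E.
rewrite iterSr.
have NSh : N.+1%:R * h = N%:R * h + h by rewrite -natr1 mulrDl mul1r.
have m1 : measurable (stays_at (grid h N) A).
  by apply: measurable_stays_at => t; exact: grid_ge0.
have m2 z : measurable [set w | X (N.+1%:R * h) w = z].
  by apply: (chain_measurable HX); rewrite mulr_ge0.
have m3 z : measurable [set w | X (N%:R * h) w = z].
  by apply: (chain_measurable HX); rewrite mulr_ge0.
transitivity (\sum_z \sum_y
   fine (Pr x (stays_at (grid h N) A `&` [set w | X (N%:R * h) w = y])) *
   (transition h y z * ((z \in A)%:R * f z))).
  apply: eq_bigr => z _; rewrite stays_at_gridS.
  have [zA|zA] := boolP (z \in A); last first.
    rewrite (_ : _ `&` _ `&` _ = set0) ?measure0/= ?mul0r.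
      by rewrite big1// => y _; rewrite ?mul0r !mulr0.
    rewrite -subset0 => w [[_ /= H] /= E]; rewrite E in H.
    by rewrite H in zA.
  have -> : stays_at (grid h N) A `&` [set w | X (N.+1%:R * h) w \in A] `&`
     [set w | X (N.+1%:R * h) w = z] =
     stays_at (grid h N) A `&` [set w | X (N.+1%:R * h) w = z].
    apply/seteqP; split => w; first by case=> -[].
    by case=> H E; split=> //; split=> //=; rewrite E.
  rewrite (fine_probability_partition (Pr x) m3); last exact: measurableI.
  rewrite mulr_suml; apply: eq_bigr => y _.
  rewrite setIAC NSh mul1r mulrA; congr (_ * _).
  have := @markov_stays_at (grid h N) A [::] (N%:R * h) h x y z h0.
  rewrite (_ : [set w | _] = setT) ?setTI; last by apply/seteqP; split.
  apply => //; first by rewrite mulr_ge0.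
  move=> t tg; rewrite (grid_ge0 h0 tg)/=.
  case/mapP: tg => i; rewrite mem_iota => /andP[_ iN] ->.
  by rewrite ler_wpM2r// ler_nat.
rewrite exchange_big/=.
under eq_bigr do rewrite -mulr_sumr.
by rewrite IH.
Qed.

Lemma survivalE h N A x : 0 <= h ->
  fine (Pr x (stays_at (grid h N) A)) = survival h A N x.
Proof.
move=> h0.
rewrite (@fine_probability_partition _ _ _ _ (Pr x) (X (N%:R * h))); last 2 first.
- by move=> y; apply: (chain_measurable HX); rewrite mulr_ge0.
- by apply: measurable_stays_at => t; exact: grid_ge0.
rewrite /survival -[X in iter _ _ X](_ : (fun y => (y \in A)%:R * 1) = _).
  by rewrite -sum_stays_at_grid//; apply: eq_bigr => y _; rewrite mulr1.
by apply/funext => y; rewrite mulr1.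
Qed.

Lemma survival_le1 h N A x : 0 <= h -> survival h A N x <= 1.
Proof.
move=> h0; rewrite -survivalE// -[leRHS](_ : fine 1%E = 1)//.
have m1 : measurable (stays_at (grid h N) A).
  by apply: measurable_stays_at => t; exact: grid_ge0.
by apply: fine_le; rewrite ?fin_num_measure// probability_le1.
Qed.

(** If [V] grows by at most [kappa h] per step inside [A], it bounds the
probability of leaving [A], by induction on the number of steps. *)
Lemma survival_ge h A (V : T -> R) (kappa : R) N x : 0 <= h -> 0 <= kappa ->
    (forall y, 0 <= V y) -> (forall y, y \notin A -> 1 <= V y) ->
    (forall y, y \in A -> \sum_z transition h y z * V z <= V y + kappa * h) ->
  1 - V x - kappa * h * N%:R <= survival h A N x.
Proof.
move=> h0 k0 V0 V1 HV; elim: N x => [|N IH] x.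
  rewrite mulr0 subr0 /survival /=.
  have [xA|xA] := boolP (x \in A); first by rewrite lerBlDr lerDl.
  by rewrite subr_le0 V1.
rewrite /survival iterS /killed_step.
have [xA|xA] := boolP (x \in A); last first.
  rewrite mul0r -addrA -opprD subr_le0 (le_trans (V1 _ xA))// lerDl.
  by rewrite !mulr_ge0.
rewrite mul1r.
apply: (@le_trans _ _ (\sum_y transition h x y * (1 - V y - kappa * h * N%:R))).
  have -> : \sum_y transition h x y * (1 - V y - kappa * h * N%:R) =
      1 - kappa * h * N%:R - \sum_y transition h x y * V y.
    rewrite -[X in X - _](mul1r _) -[X in X * _ - _](sum_transition x h0) mulr_suml.
    by rewrite -sumrB; apply: eq_bigr => y _; rewrite -mulrBr addrAC.
  by have := HV _ xA; rewrite -natr1 mulrDr mulr1; lra.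
by apply: ler_sum => y _; rewrite ler_wpM2l ?transition_ge0//; exact: IH.
Qed.

(** If [V] decreases by at least [kappa h] per step on the states of [A] where it
is smaller than one, then staying in [A] is unlikely: a path that does so either
meets a state with [V >= 1] or keeps consuming [V]. *)
Lemma survival_le h A (V : T -> R) (kappa : R) N x : 0 <= h -> 0 <= kappa ->
    kappa * h * N%:R <= 1 ->
    (forall y, 0 <= V y) ->
    (forall y, y \in A -> 1 <= V y \/
      \sum_z transition h y z * V z <= V y - kappa * h) ->
  survival h A N x <= V x + 1 - kappa * h * N%:R.
Proof.
move=> h0 k0 + V0 HV; elim: N x => [|N IH] x kN.
  rewrite mulr0 subr0 /survival /=.
  by apply: (@le_trans _ _ 1); [case: (x \in A)|rewrite lerDr].
have [xA|xA] := boolP (x \in A); last first.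
  rewrite /survival iterS /killed_step (negbTE xA) mul0r.
  by have := V0 x; lra.
have [V1|HVx] := HV _ xA.
  by apply: le_trans (survival_le1 _ _ _ h0) _; lra.
rewrite /survival iterS /killed_step xA mul1r.
apply: (@le_trans _ _ (\sum_y transition h x y * (V y + 1 - kappa * h * N%:R))).
  apply: ler_sum => y _; rewrite ler_wpM2l ?transition_ge0//; apply: IH.
  by apply: le_trans kN; rewrite ler_wpM2l ?mulr_ge0// ler_nat.
have -> : \sum_y transition h x y * (V y + 1 - kappa * h * N%:R) =
    1 - kappa * h * N%:R + \sum_y transition h x y * V y.
  rewrite -[X in X + _](mul1r _) -[X in X * _ + _](sum_transition x h0) mulr_suml.
  by rewrite -big_split /=; apply: eq_bigr => y _; rewrite -mulrDr; congr (_ * _); lra.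
by rewrite -natr1 mulrDr mulr1; lra.
Qed.

End FiniteChain.

(** * Passage to continuous time *)

Section ContinuousTime.
Context (R : realType) (T : finType) (q : T -> T -> R)
  (d : measure_display) (Omega : measurableType d)
  (Pr : T -> probability Omega R) (X : R -> Omega -> T).
Hypothesis HX : is_markov_chain q Pr X.

Implicit Types (x y z : T) (A : {set T}) (f V : T -> R).

Lemma cvg_transition_quotient f x :
  (\sum_y transition Pr X h x y * f y - f x) / h @[h --> 0^'+] --> generator q f x.
Proof.
have H : \sum_(y | y != x) transition Pr X h x y / h * (f y - f x)
    @[h --> 0^'+] --> generator q f x.
  apply: cvg_big => [|y yx]; first exact: add_continuous.
  apply: cvgMr_tmp.
  by apply: (chain_rates HX); rewrite eq_sym.
apply: cvg_trans H; apply: near_eq_cvg; near=> h.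
have h0 : 0 < h by [].
have -> : \sum_y transition Pr X h x y * f y - f x =
    \sum_y transition Pr X h x y * (f y - f x).
  under [RHS]eq_bigr do rewrite mulrBr.
  by rewrite sumrB -mulr_suml (sum_transition HX)// ?mul1r// ltW.
rewrite [in RHS](bigD1 x)//= subrr mulr0 add0r mulr_suml.
by apply: eq_bigr => y _; rewrite mulrAC.
Unshelve. all: by end_near. Qed.

(** Over short time steps the mean of [f] grows at most at any rate that
strictly exceeds the generator, uniformly in the starting point. *)
Lemma near_transition_le f (c : T -> R) :
  \forall h \near 0^'+, forall x, generator q f x < c x ->
    \sum_y transition Pr X h x y * f y <= f x + c x * h.
Proof.
apply: filter_forall => x.
have [gc|gc] := ltP (generator q f x) (c x); last first.
  by apply: nearW => h.
have := cvgr_lt _ (@cvg_transition_quotient f x) _ gc.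
move=> H; have H0 := nbhs_right_gt (0 : R).
apply: (filterS2 _ _ H0 (H _)) => h h0 Hh _.
by rewrite -lerBlDl -ler_pdivrMr// ltW.
Qed.

(** The paths that stay in [A] during the whole interval [0, t]. *)
Definition stays_upto (t : R) (A : {set T}) : set Omega :=
  [set w | forall s, 0 <= s <= t -> X s w \in A].

(** Dyadic fractions of [t] are dense from the right in the interval [0, t]. *)
Lemma grid_point_between (t h s : R) : 0 < h -> 0 <= s < t ->
  exists m i, [/\ (i <= 2 ^ m)%N & s <= i%:R * (t / 2 ^+ m) < s + h].
Proof.
move=> h0 /andP[s0 st].
have t0 : 0 < t by apply: le_lt_trans st.
pose e := Num.min h (t - s).
have e0 : 0 < e by rewrite lt_min h0 subr_gt0.
pose m := Num.truncn (t / e); exists m.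
have m2 : t / 2 ^+ m < e.
  rewrite ltr_pdivrMr ?exprn_gt0// mulrC -ltr_pdivrMr//.
  apply: lt_le_trans (truncnS_gt _) _.
  by rewrite -natrX ler_nat ltn_expl.
set u := t / 2 ^+ m in m2 *.
have u0 : 0 < u by rewrite divr_gt0// exprn_gt0.
exists (Num.truncn (s / u)).+1.
have /andP[H1 H2] := @truncn_itv _ (s / u) (divr_ge0 s0 (ltW u0)).
have H3 : (Num.truncn (s / u)).+1%:R * u <= s + u.
  by rewrite -natr1 mulrDl mul1r lerD2r -ler_pdivlMr.
have H4 : s <= (Num.truncn (s / u)).+1%:R * u.
  by rewrite -ler_pdivrMr// ltW.
have H5 : (Num.truncn (s / u)).+1%:R * u < s + e by apply: le_lt_trans H3 _; rewrite ltrD2l.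
split.
  have : (Num.truncn (s / u)).+1%:R * u <= t.
    by apply: ltW; apply: lt_le_trans H5 _; rewrite -lerBrDl ge_min lexx orbT.
  rewrite /u mulrA ler_pdivrMr ?exprn_gt0// [leRHS]mulrC ler_pM2r//.
  by rewrite -natrX ler_nat.
rewrite H4/=; apply: lt_le_trans H5 _.
by rewrite lerD2l ge_min lexx.
Qed.

Lemma stays_upto_bigcap t A : 0 <= t ->
  stays_upto t A = \bigcap_m stays_at X (grid (t / 2 ^+ m) (2 ^ m)) A.
Proof.
move=> t0; apply/seteqP; split => [w H m _ s /mapP[i]|w H s /andP[s0]].
  rewrite mem_iota add0n ltnS => /andP[_ im] ->; apply: H.
  rewrite mulr_ge0 ?divr_ge0 ?exprn_ge0//= mulrA ler_pdivrMr ?exprn_gt0//.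
  by rewrite mulrC ler_wpM2l// -natrX ler_nat.
rewrite le_eqVlt => /orP[/eqP ->|st].
  apply: (H 0%N) => //; rewrite /grid /= expr0 divr1 !inE mul1r eqxx orbT//.
have [h h0 Hh] := chain_right_continuous HX w s0.
have [|m [i [im ih]]] := @grid_point_between t h s h0; first by rewrite s0.
rewrite -(Hh _ ih); apply: (H m) => //; apply/mapP; exists i => //.
by rewrite mem_iota add0n ltnS.
Qed.

Lemma measurable_stays_upto t A : 0 <= t -> measurable (stays_upto t A).
Proof.
move=> t0; rewrite stays_upto_bigcap//; apply: bigcapT_measurable => m.
apply: (measurable_stays_at HX) => s; apply: grid_ge0.
by rewrite divr_ge0// exprn_ge0.
Qed.

Lemma cvg_survival t A x : 0 < t ->
  survival Pr X (t / 2 ^+ m) A (2 ^ m) x @[m --> \oo] -->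
    fine (Pr x (stays_upto t A)).
Proof.
move=> t0; have h0 m : 0 <= t / 2 ^+ m by rewrite divr_ge0 ?exprn_ge0// ltW.
under eq_fun do rewrite -(survivalE HX)//.
have mE m : measurable (stays_at X (grid (t / 2 ^+ m) (2 ^ m)) A).
  by apply: (measurable_stays_at HX) => s; apply: grid_ge0.
have mS := @measurable_stays_upto t A (ltW t0).
apply: fine_cvg; rewrite fineK ?fin_num_measure// stays_upto_bigcap ?ltW//.
apply: nonincreasing_cvg_mu => //.
- by rewrite (le_lt_trans (probability_le1 _ _))// ltry.
- by rewrite -stays_upto_bigcap// ltW.
apply/nonincreasing_seqP => m; apply/subsetPset => w H s /mapP[i].
rewrite mem_iota add0n ltnS => /andP[_ im] ->; apply: H.
apply/mapP; exists (2 * i)%N.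
  by rewrite mem_iota add0n ltnS expnS leq_mul2l im orbT.
by rewrite natrM exprS; field.
Qed.

Lemma near_dyadic (t : R) (P : R -> Prop) : 0 < t ->
  (\forall h \near 0^'+, P h) -> \forall m \near \oo, P (t / 2 ^+ m).
Proof.
move=> t0 [e /= e0 He]; exists (Num.truncn (t / e)) => // m /= em.
have tm0 : 0 < t / 2 ^+ m by rewrite divr_gt0// exprn_gt0.
apply: He => //=; rewrite sub0r normrN gtr0_norm//.
rewrite ltr_pdivrMr ?exprn_gt0// mulrC -ltr_pdivrMr//.
apply: lt_le_trans (truncnS_gt _) _; rewrite -natrX ler_nat.
by apply: leq_ltn_trans em _; exact: ltn_expl.
Qed.

Lemma dyadic_mul (t : R) m : t / 2 ^+ m * (2 ^ m)%:R = t.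
Proof. by rewrite natrX mulfVK// expf_neq0. Qed.

(** Lyapunov bound from below for the probability of staying in [A]. *)
Lemma stays_upto_ge t A V kappa x : 0 < t -> 0 <= kappa ->
    (forall y, 0 <= V y) -> (forall y, y \notin A -> 1 <= V y) ->
    (forall y, y \in A -> generator q V y < kappa) ->
  1 - V x - kappa * t <= fine (Pr x (stays_upto t A)).
Proof.
move=> t0 k0 V0 V1 HV; apply: (cvgr_to_ge (@cvg_survival t A x t0)).
have := near_dyadic t0 (near_transition_le V (fun=> kappa)).
apply: filterS => m Hm.
rewrite -[X in kappa * X](dyadic_mul t m) mulrA.
apply: (survival_ge HX) => //; first by rewrite divr_ge0 ?exprn_ge0// ltW.
by move=> y yA; apply: Hm; exact: HV.
Qed.

(** Lyapunov bound from above for the probability of staying in [A]. *)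
Lemma stays_upto_le t A V kappa x : 0 < t -> 0 <= kappa -> kappa * t <= 1 ->
    (forall y, 0 <= V y) ->
    (forall y, y \in A -> 1 <= V y \/ generator q V y < - kappa) ->
  fine (Pr x (stays_upto t A)) <= V x + 1 - kappa * t.
Proof.
move=> t0 k0 kt V0 HV; apply: (cvgr_to_le (@cvg_survival t A x t0)).
have := near_dyadic t0 (near_transition_le V (fun=> - kappa)).
apply: filterS => m Hm.
rewrite -[X in kappa * X](dyadic_mul t m) mulrA.
apply: (survival_le HX) => //; first by rewrite divr_ge0 ?exprn_ge0// ltW.
  by rewrite -mulrA dyadic_mul.
move=> y yA; have [?|Hy] := HV _ yA; [by left|right].
by rewrite -mulNr; apply: Hm.
Qed.

(** By right continuity, the entrance time exceeds [t] exactly when the path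
avoids the set on the closed interval [0, t]. *)
Lemma T_enter_gtE (g : T -> R) (B : set R) t : 0 <= t ->
  [set w | (t%:E < T_enter (fun s => g (X s w)) B)%E] =
  stays_upto t [set y | ~~ `[< B (g y) >]]%SET.
Proof.
move=> t0; apply/seteqP; split => w /=.
  move=> H s /andP[s0 st]; rewrite inE; apply/asboolPn => Bs.
  move: H; rewrite ltNge => /negP; apply.
  by apply: le_trans (_ : s%:E <= _)%E; [apply: ereal_inf_lbound; exists s|rewrite lee_fin].
move=> H; have [h h0 Hh] := chain_right_continuous HX w t0.
apply: (@lt_le_trans _ _ (t + h)%:E); first by rewrite lte_fin ltrDl.
apply: le_ereal_inf_tmp => _ [s [s0 Bs] <-]; rewrite lee_fin leNgt; apply/negP => sth.
have [st|ts] := leP s t.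
  by have := H s; rewrite s0 st inE => /(_ isT)/asboolPn; apply.
have := H t; rewrite t0 lexx inE => /(_ isT)/asboolPn; apply.
by rewrite -(Hh s)// (ltW ts).
Qed.

(** The exit time is at least [t] exactly when the path stays in the set before
[t]; the half-open interval is exhausted by closed ones. *)
Lemma T_exit_geE (g : T -> R) (B : set R) t : 0 < t ->
  [set w | (t%:E <= T_exit (fun s => g (X s w)) B)%E] =
  \bigcap_j stays_upto (t * (j%:R / j.+1%:R)) [set y | `[< B (g y) >]]%SET.
Proof.
move=> t0; apply/seteqP; split => w /=.
  move=> H j _ s /andP[s0 st]; rewrite inE; apply/asboolP; apply: contrapT => Bs.
  move: H; rewrite leNgt => /negP; apply.
  apply: (@le_lt_trans _ _ s%:E); first by apply: ereal_inf_lbound; exists s.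
  rewrite lte_fin (le_lt_trans st)// -[ltRHS]mulr1 ltr_pM2l//.
  by rewrite ltr_pdivrMr// mul1r ltr_nat.
move=> H; apply: le_ereal_inf_tmp => _ [s [s0 Bs] <-].
rewrite lee_fin leNgt; apply/negP => st; apply: Bs; apply/asboolP.
have ts0 : 0 < t - s by rewrite subr_gt0.
pose j := Num.truncn (t / (t - s)).
have := H j I s; rewrite inE; apply; rewrite s0/=.
have /ltW := truncnS_gt (t / (t - s)); rewrite -/j ler_pdivrMr// mulrA ler_pdivlMr//.
by rewrite -natr1; lra.
Qed.

Lemma measurable_T_enter_gt (g : T -> R) (B : set R) t : 0 <= t ->
  measurable [set w | (t%:E < T_enter (fun s => g (X s w)) B)%E].
Proof. by move=> t0; rewrite T_enter_gtE//; exact: measurable_stays_upto. Qed.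

Lemma measurable_T_exit_ge (g : T -> R) (B : set R) t : 0 < t ->
  measurable [set w | (t%:E <= T_exit (fun s => g (X s w)) B)%E].
Proof.
move=> t0; rewrite T_exit_geE//; apply: bigcapT_measurable => j.
by apply: measurable_stays_upto; rewrite mulr_ge0// ltW.
Qed.

Lemma stays_upto_sub_T_exit (g : T -> R) (B : set R) t : 0 < t ->
  stays_upto t [set y | `[< B (g y) >]]%SET `<=`
  [set w | (t%:E <= T_exit (fun s => g (X s w)) B)%E].
Proof.
move=> t0 w H; rewrite T_exit_geE// => j _ s /andP[s0 st]; apply: H.
rewrite s0/= (le_trans st)// -[leRHS]mulr1 ler_pM2l//.
by rewrite ler_pdivrMr// mul1r ler_nat.
Qed.

End ContinuousTime.

(** * The drift polynomial *)

Lemma horner_majority (R : realType) k (x : R) :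
  (majority_poly R k).[x] =
  \sum_(k.+1 <= r < (2 * k).+1)
    'C(2 * k, r)%:R * (x ^+ r * (1 - x) ^+ (2 * k - r)).
Proof.
rewrite horner_sum; apply: eq_bigr => r _.
by rewrite hornerZ hornerM hornerXn !(horner_exp, hornerE).
Qed.

Lemma majority_ge0 (R : realType) k (x : R) : 0 <= x <= 1 ->
  0 <= (majority_poly R k).[x].
Proof.
move=> /andP[x0 x1]; rewrite horner_majority; apply: sumr_ge0 => r _.
by rewrite !mulr_ge0// exprn_ge0// subr_ge0.
Qed.

Lemma majority_gt0 (R : realType) k (x : R) : (1 <= k)%N -> 0 < x < 1 ->
  0 < (majority_poly R k).[x].
Proof.
move=> k1 /andP[x0 x1]; rewrite horner_majority big_nat_recr/=; last first.
  by rewrite mulSn mul1n -[X in (X < _)%N]addn0 ltn_add2l.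
rewrite ltr_wpDl//; last first.
  by rewrite binn mul1r subnn expr0 mulr1 exprn_gt0.
apply: sumr_ge0 => r _.
by rewrite !mulr_ge0// exprn_ge0// ?subr_ge0 ltW.
Qed.

Lemma poly_bounded_lipschitz (R : realType) (p : {poly R}) :
  exists2 K : R, 0 <= K & forall x y : R, 0 <= x <= 1 -> 0 <= y <= 1 ->
    `|p.[x]| <= K /\ `|p.[x] - p.[y]| <= K * `|x - y|.
Proof.
elim/poly_ind: p => [|p c [K K0 HK]].
  by exists 0 => // x y _ _; rewrite !horner0 subrr normr0 mul0r.
exists (2 * K + `|c|); first by rewrite addr_ge0 ?mulr_ge0.
move=> x y x01 y01; rewrite !hornerE.
have [px pxy] := HK _ _ x01 y01; have [py _] := HK _ _ y01 y01.
have x1 : `|x| <= 1 by case/andP: x01 => ? ?; rewrite ger0_norm.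
split.
  rewrite (le_trans (ler_normD _ _))// lerD2r normrM.
  have : `|p.[x]| * `|x| <= K * 1 by rewrite ler_pM.
  by lra.
have -> : p.[x] * x + c - (p.[y] * y + c) =
  (p.[x] - p.[y]) * x + p.[y] * (x - y) by ring.
rewrite (le_trans (ler_normD _ _))// !normrM.
have : `|p.[x] - p.[y]| * `|x| <= K * `|x - y| * 1.
  by rewrite ler_pM.
have : `|p.[y]| * `|x - y| <= K * `|x - y| by rewrite ler_wpM2r.
have : 0 <= `|c| * `|x - y| by rewrite mulr_ge0.
by lra.
Qed.

Section Drift.
Context (R : realType) (k : nat) (g0 g1 r1 rm r2 : R).
Hypothesis k1 : (1 <= k)%N.
Hypothesis hG : Gamma_sub k g0 g1.
Hypothesis r1m : r1 < rm.
Hypothesis rm2 : rm < r2.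
Hypothesis hroots : drift_roots k g0 g1 [:: r1; rm; r2].

Local Notation S := (Sspace g0 g1).
Local Notation Delta := (drift k g0 g1).

Lemma horner_drift x : Delta.[x] =
  (1 - x - g0) * (majority_poly R k).[x]
  - (x - g1) * (majority_poly R k).[1 - x].
Proof. by rewrite /drift !hornerE horner_comp !hornerE. Qed.

Lemma drift_left_end_gt0 : 0 < Delta.[g1].
Proof.
have [[/andP[h0 _] /andP[h1 _] /andP[_ h01]] _] := hG.
rewrite horner_drift subrr mul0r subr0; apply: mulr_gt0; first by lra.
by apply: majority_gt0 => //; apply/andP; split=> //; lra.
Qed.

Lemma root_in_S r : r \in [:: r1; rm; r2] -> S r /\ root Delta r.
Proof. by move=> H; apply/(hroots.2 r). Qed.

(** The drift is a cubic with the three given roots times a cofactor that is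
negative and bounded away from zero on the state space. *)
Lemma drift_factor : exists Q : {poly R}, exists2 q0, 0 < q0 &
  forall x, S x -> Q.[x] <= - q0 /\
    Delta.[x] = (x - r1) * (x - rm) * (x - r2) * Q.[x].
Proof.
have [[/andP[h0 _] /andP[h1 _] /andP[_ h01]] _] := hG.
have D0 : Delta != 0.
  by apply/eqP => D0; have := drift_left_end_gt0; rewrite D0 horner0 ltxx.
have [Q DQ] : exists Q, Delta = Q * \prod_(z <- [:: r1; rm; r2]) ('X - z%:P).
  apply: uniq_roots_prod_XsubC; last by rewrite uniq_rootsE; case: hroots.
  by apply/allP => r /root_in_S[].
have DE x : Delta.[x] = (x - r1) * (x - rm) * (x - r2) * Q.[x].
  by rewrite DQ !big_cons big_nil mulr1 !hornerM !hornerXsubC; ring.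
have [S1 [Sm S2]] : S r1 /\ S rm /\ S r2.
  by split; [|split]; apply: (root_in_S _).1; rewrite !inE eqxx ?orbT.
(* a root of [Q] in the state space would be a multiple root of the drift *)
have nrootQ x : S x -> ~~ root Q x.
  move=> Sx; apply/negP => Qx.
  have Dx : root Delta x by rewrite rootE DE (eqP Qx) mulr0.
  have xr : x \in [:: r1; rm; r2] by apply/(hroots.2 x).
  have mx : mup x Delta = 1%N.
    case: hG => _ [s [_ hs ms]]; apply: ms; apply/(hs.2 x).
    by split.
  have /factor_theorem[Q' QE] := Qx.
  have : (2 <= mup x Delta)%N.
    rewrite mup_geq// DQ QE.
    rewrite (perm_big (x :: rem x [:: r1; rm; r2]))/=; last exact: perm_to_rem.
    rewrite big_cons; set B := \prod_(_ <- _) _.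
    have -> : Q' * ('X - x%:P) * (('X - x%:P) * B) =
      ('X - x%:P) ^+ 2 * (Q' * B) by ring.
    by rewrite dvdp_mulIl.
  by rewrite mx.
have Sg1 : S g1 by rewrite /Sspace/= lexx/=; lra.
(* the drift is positive at the left end, where all linear factors are
   nonpositive *)
have Qg1 : Q.[g1] < 0.
  have := drift_left_end_gt0; rewrite DE => H.
  rewrite ltNge; apply/negP => Q0.
  have : 0 <= (r1 - g1) * (rm - g1) * (r2 - g1) * Q.[g1].
    rewrite !mulr_ge0// subr_ge0; first by case/andP: S1.
      by case/andP: Sm.
    by case/andP: S2.
  have -> : (r1 - g1) * (rm - g1) * (r2 - g1) * Q.[g1] =
    - ((g1 - r1) * (g1 - rm) * (g1 - r2) * Q.[g1]) by ring.
  by lra.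
have Qneg x : S x -> Q.[x] < 0.
  move=> Sx; rewrite ltNge; apply/negP => Qx.
  have g1x : g1 <= x by case/andP: Sx.
  have [|y /andP[gy yx] Qy] := @poly_ivt _ Q g1 x g1x.
    by rewrite (ltW Qg1).
  have /nrootQ/negP : S y by rewrite /Sspace/= gy (le_trans yx)//; case/andP: Sx.
  exact.
have [c cS Hc] : exists2 c, c \in `[g1, 1 - g0]%R &
    forall t, t \in `[g1, 1 - g0]%R -> Q.[t] <= Q.[c].
  apply: EVT_max; first by lra.
  by apply: continuous_subspaceT => x; exact: continuous_horner.
exists Q, (- Q.[c]).
  by rewrite oppr_gt0; apply: Qneg; move: cS; rewrite in_itv.
move=> x Sx; split; last exact: DE.
by rewrite opprK; apply: Hc; rewrite in_itv.
Qed.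

(** [is_well r s]: [r] is the stable zero of the drift on the side [s] (plus
or minus one) of the unstable zero [rm]. *)
Definition is_well (r s : R) : Prop := (r = r1 /\ s = -1) \/ (r = r2 /\ s = 1).

Lemma is_well_sqr r s : is_well r s -> s * s = 1.
Proof. by case=> -[_ ->]; rewrite ?mulrNN mulr1. Qed.

Lemma is_well_gt0 r s : is_well r s -> 0 < s * (r - rm).
Proof.
have [h1 h2] : r1 < rm /\ rm < r2 by [].
by case=> -[-> ->]; lra.
Qed.

Lemma is_well_S r s : is_well r s -> S r.
Proof. by case=> -[-> _]; apply: (root_in_S _).1; rewrite !inE eqxx ?orbT. Qed.

(** On the side of [rm] where the well lies, the drift points to the well, with
a strength bounded below away from the zeros. *)
Lemma drift_sign r s eta : is_well r s -> 0 < eta ->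
  exists2 m : R, 0 < m & forall x, S x -> eta <= s * (x - rm) ->
    (x <= r - eta -> m <= Delta.[x]) /\ (r + eta <= x -> Delta.[x] <= - m).
Proof.
have [h1 h2] : r1 < rm /\ rm < r2 by [].
move=> rs eta0; have [Q [q0 q00 HQ]] := drift_factor.
exists (eta ^+ 3 * q0); first by rewrite mulr_gt0// exprn_gt0.
move=> x Sx; have [Qx ->] := HQ _ Sx.
have prod3 a b c : eta <= a -> eta <= b -> eta <= c ->
    eta ^+ 3 * q0 <= a * b * c * (- Q.[x]).
  move=> ha hb hc; have ? := ltW eta0; have ? := ltW q00.
  rewrite !exprS expr0 mulr1 mulrA !ler_pM ?mulr_ge0//.
  by rewrite lerNr.
case: rs => -[-> ->] xm; split=> xr.
- have := prod3 (r1 - x) (rm - x) (r2 - x); rewrite !mulrN.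
  have -> : (r1 - x) * (rm - x) * (r2 - x) * Q.[x] =
    - ((x - r1) * (x - rm) * (x - r2) * Q.[x]) by ring.
  by rewrite opprK; apply; lra.
- have := prod3 (x - r1) (rm - x) (r2 - x); rewrite !mulrN.
  have -> : (x - r1) * (rm - x) * (r2 - x) * Q.[x] =
    (x - r1) * (x - rm) * (x - r2) * Q.[x] by ring.
  by rewrite lerNr; apply; lra.
- have := prod3 (x - r1) (x - rm) (r2 - x); rewrite !mulrN.
  have -> : (x - r1) * (x - rm) * (r2 - x) * Q.[x] =
    - ((x - r1) * (x - rm) * (x - r2) * Q.[x]) by ring.
  by rewrite opprK; apply; lra.
- have := prod3 (x - r1) (x - rm) (x - r2); rewrite !mulrN.
  by rewrite lerNr; apply; lra.
Qed.

End Drift.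

(** * The jump rates *)

Lemma natr_absz_ceil (R : realType) (x : R) : 0 <= x ->
  x <= `|Num.ceil x|%N%:R < x + 1.
Proof.
move=> x0; have c0 : 0 <= Num.ceil x by rewrite ceil_ge0 (lt_le_trans _ x0)// ltrN10.
rewrite natr_absz ger0_norm//.
have /andP[H1 H2] := ceil_itv x; rewrite H2/=.
by move: H1; rewrite intrD; lra.
Qed.

Lemma stubborn_bounds (R : realType) (g : R) n : 0 <= g ->
  n%:R * g <= (stubborn n g)%:R < n%:R * g + 1.
Proof. by move=> g0'; apply: natr_absz_ceil; rewrite mulr_ge0. Qed.

Lemma near_nonempty_states (R : realType) (g0 g1 : R) : Gamma g0 g1 ->
  \forall n \near \oo, nonempty_states g0 g1 n.
Proof.
move=> [/andP[h0 _] /andP[h1 _] /andP[_ h01]].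
have e0 : 0 < 1 - (g0 + g1) by lra.
apply: filterS (nbhs_infty_ger (2 / (1 - (g0 + g1)))) => n.
rewrite ler_pdivrMr// /nonempty_states -(ler_nat R) natrD => H.
have /andP[_] := stubborn_bounds n (ltW h0).
have /andP[_] := stubborn_bounds n (ltW h1).
by move: H; rewrite mulrBr mulrDr mulr1; lra.
Qed.

Section Rates.
Context (R : realType) (k : nat) (g0 g1 : R).

Lemma prop1_bounds n (j : state g0 g1 n) :
    (0 < n)%N -> nonempty_states g0 g1 n ->
  (stubborn n g1)%:R / n%:R <= prop1 j <= 1 - (stubborn n g0)%:R / n%:R.
Proof.
move=> n0 ne; have n0R : 0 < n%:R :> R by rewrite ltr0n.
rewrite /prop1 ler_pM2r ?invr_gt0// ler_nat leq_addr/=.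
rewrite lerBrDr -mulrDl ler_pdivrMr// mul1r -natrD ler_nat.
have := ltn_ord j; move: ne; rewrite /nonempty_states.
by move: (stubborn _ _) (stubborn _ _) (nat_of_ord j) => a b c; lia.
Qed.

Lemma prop1_S n (j : state g0 g1 n) : 0 <= g0 -> 0 <= g1 ->
    (0 < n)%N -> nonempty_states g0 g1 n ->
  Sspace g0 g1 (prop1 j).
Proof.
move=> h0 h1 n0 ne; have n0R : 0 < n%:R :> R by rewrite ltr0n.
have /andP[H1 H2] := prop1_bounds j n0 ne.
have /andP[s0 _] := stubborn_bounds n h0.
have /andP[s1 _] := stubborn_bounds n h1.
rewrite /Sspace/=; apply/andP; split.
  by apply: le_trans H1; rewrite ler_pdivlMr// mulrC.
apply: le_trans H2 _; rewrite lerD2l lerN2 ler_pdivlMr//.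
by rewrite mulrC.
Qed.

(** In a rate, replacing the proportion [u] of agents that may still flip by its
limit [u'] and removing the resampling factor costs order [1/n]; the resampled
argument also stays a probability. *)
Lemma rate_estimate (p : {poly R}) (K u u' y n : R) :
    (forall x y : R, 0 <= x <= 1 -> 0 <= y <= 1 ->
      `|p.[x]| <= K /\ `|p.[x] - p.[y]| <= K * `|x - y|) ->
    2 <= n -> 0 <= u <= 1 -> 0 <= u' <= 1 -> `|u - u'| <= n^-1 ->
    0 <= y <= 1 - n^-1 ->
  `|u * p.[n / (n - 1) * y] - u' * p.[y]| <= 3 * K * n^-1 /\
  (0 <= n / (n - 1) * y <= 1).
Proof.
move=> HK n2 u01 u01' uu' /andP[y0 y1].
have n0 : 0 < n by lra.
have n1 : 0 < n - 1 by lra.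
have K0 : 0 <= K.
  have z01 : 0 <= (0 : R) <= 1 by rewrite lexx ler01.
  by have [+ _] := HK _ _ z01 z01; apply: le_trans.
have ny1 : 0 <= n / (n - 1) * y <= 1.
  rewrite mulr_ge0 ?divr_ge0 ?(ltW n0) ?(ltW n1)//=.
  rewrite mulrAC ler_pdivrMr// mul1r.
  have : n * y <= n * (1 - n^-1) by rewrite ler_pM2l.
  by rewrite mulrBr mulr1 divff ?gt_eqF.
have n'0 : 0 <= n^-1 by rewrite invr_ge0 ltW.
have y01 : 0 <= y <= 1 by rewrite y0/=; lra.
split=> //.
have [pb pl] := HK _ _ ny1 y01.
have dy : `|n / (n - 1) * y - y| <= 2 * n^-1.
  have -> : n / (n - 1) * y - y = y / (n - 1) by field; rewrite gt_eqF.
  rewrite ger0_norm ?divr_ge0// ?(ltW n1)//.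
  rewrite ler_pdivrMr//.
  have -> : 2 * n^-1 * (n - 1) = 2 - 2 * n^-1 by field; rewrite gt_eqF.
  have : n^-1 <= 2^-1 by rewrite lef_pV2 ?posrE.
  by case/andP: y01; lra.
have -> : u * p.[n / (n - 1) * y] - u' * p.[y] =
  (u - u') * p.[n / (n - 1) * y] + u' * (p.[n / (n - 1) * y] - p.[y]) by ring.
rewrite (le_trans (ler_normD _ _))// !normrM.
have : `|u - u'| * `|p.[n / (n - 1) * y]| <= n^-1 * K by rewrite ler_pM.
have : `|u'| * `|p.[n / (n - 1) * y] - p.[y]| <= 1 * (K * (2 * n^-1)).
  rewrite ler_pM//; first by case/andP: u01' => ? ?; rewrite ger0_norm.
  by apply: le_trans pl _; rewrite ler_wpM2l.
by lra.
Qed.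

(** The jump rates are [n] times bounded coefficients whose difference is the
limiting drift up to an error of order [1/n]. *)
Lemma rates_drift : Gamma g0 g1 ->
  exists2 K : R, 1 <= K & forall n (j : state g0 g1 n),
    (2 <= n)%N -> nonempty_states g0 g1 n ->
    exists a b, [/\ rate_up k g0 n (prop1 j) = n%:R * a,
      rate_down k g1 n (prop1 j) = n%:R * b, 0 <= a <= K, 0 <= b <= K &
      `|a - b - (drift k g0 g1).[prop1 j]| <= K / n%:R].
Proof.
move=> [/andP[h0 _] /andP[h1 _] /andP[_ h01]].
have [K0 K00 HK] := poly_bounded_lipschitz (majority_poly R k).
exists (6 * K0 + 1); first by rewrite lerDr mulr_ge0.
move=> n j n2 ne.
have n2R : 2 <= n%:R :> R by rewrite ler_nat.
have n0R : 0 < n%:R :> R by lra.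
have n0 : (0 < n)%N by rewrite (leq_trans _ n2).
have /andP[b1 b2] := prop1_bounds j n0 ne.
have /andP[S1 S2] := prop1_S j (ltW h0) (ltW h1) n0 ne.
have /andP[s0 s0'] := stubborn_bounds n (ltW h0).
have /andP[s1 s1'] := stubborn_bounds n (ltW h1).
set x := prop1 j in b1 b2 S1 S2 *.
set N0 : R := (stubborn n g0)%:R in b2 s0 s0' *.
set N1 : R := (stubborn n g1)%:R in b1 s1 s1' *.
have N0g : 0 <= N0 / n%:R - g0 <= n%:R^-1.
  rewrite subr_ge0 ler_pdivlMr// [g0 * _]mulrC s0/= lerBlDr ler_pdivrMr//.
  by rewrite mulrDl mulVf ?gt_eqF// [g0 * _]mulrC addrC ltW.
have N1g : 0 <= N1 / n%:R - g1 <= n%:R^-1.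
  rewrite subr_ge0 ler_pdivlMr// [g1 * _]mulrC s1/= lerBlDr ler_pdivrMr//.
  by rewrite mulrDl mulVf ?gt_eqF// [g1 * _]mulrC addrC ltW.
have stub1 (g : R) : 0 < g -> n%:R^-1 <= (stubborn n g)%:R / n%:R :> R.
  move=> g0'; rewrite -[leLHS]mul1r ler_pM2r ?invr_gt0// (ler_nat R 1).
  rewrite -(ltr_nat R); have /andP[+ _] := stubborn_bounds n (ltW g0').
  by apply: lt_le_trans; rewrite mulr_gt0.
have N0n := stub1 _ h0; have N1n := stub1 _ h1.
rewrite -/N0 -/N1 in N0n N1n.
have n'0 : 0 < n%:R^-1 :> R by rewrite invr_gt0.
exists ((1 - x - N0 / n%:R) * (majority_poly R k).[resampling R n * x]).
exists ((x - N1 / n%:R) * (majority_poly R k).[resampling R n * (1 - x)]).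
case/andP: N0g => N0g N0g'; case/andP: N1g => N1g N1g'.
have [||||E1 r1] := @rate_estimate _ K0 (1 - x - N0 / n%:R) (1 - x - g0) x n%:R HK n2R.
- by apply/andP; split; lra.
- by apply/andP; split; lra.
- by rewrite (_ : _ - _ = - (N0 / n%:R - g0)); [rewrite normrN ger0_norm|ring].
- by apply/andP; split; lra.
have [||||E2 r2] := @rate_estimate _ K0 (x - N1 / n%:R) (x - g1) (1 - x) n%:R HK n2R.
- by apply/andP; split; lra.
- by apply/andP; split; lra.
- by rewrite (_ : _ - _ = - (N1 / n%:R - g1)); [rewrite normrN ger0_norm|ring].
- by apply/andP; split; lra.
have bnd u y : 0 <= u <= 1 -> 0 <= y <= 1 ->
    0 <= u * (majority_poly R k).[y] <= 6 * K0 + 1.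
  move=> /andP[u0 u1] y01; rewrite mulr_ge0 ?majority_ge0//=.
  have [+ _] := HK _ _ y01 y01; rewrite ger0_norm ?majority_ge0// => H.
  have : u * (majority_poly R k).[y] <= 1 * K0 by rewrite ler_pM// majority_ge0.
  by lra.
split.
- by rewrite /rate_up -mulrA.
- by rewrite /rate_down -mulrA.
- by apply: bnd => //; apply/andP; split; lra.
- by apply: bnd => //; apply/andP; split; lra.
rewrite horner_drift.
set A := _ * _ in E1 *; set B := _ * _ in E2 *.
set A' := (1 - x - g0) * _ in E1 *; set B' := (x - g1) * _ in E2 *.
have -> : A - B - (A' - B') = (A - A') - (B - B') by ring.
rewrite (le_trans (ler_normB _ _))// mulrDl mul1r.
by lra.
Qed.

(** At the extreme states the outward rate vanishes, so that the generator acts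
on a function of the proportion as that of a birth-death chain on the line. *)
Lemma generator_prop1 n (F : R -> R) (j : state g0 g1 n) :
    (0 < n)%N -> nonempty_states g0 g1 n ->
  generator (@jump_rate R k g0 g1 n) (fun i => F (prop1 i)) j =
  rate_up k g0 n (prop1 j) * (F (prop1 j + n%:R^-1) - F (prop1 j)) +
  rate_down k g1 n (prop1 j) * (F (prop1 j - n%:R^-1) - F (prop1 j)).
Proof.
move=> n0 ne; have n0R : n%:R != 0 :> R by rewrite pnatr_eq0 -lt0n.
set u := rate_up _ _ _ _; set v := rate_down _ _ _ _.
rewrite /generator (eq_bigr (fun y : state g0 g1 n =>
  (if nat_of_ord y == j.+1 then u * (F (prop1 j + n%:R^-1) - F (prop1 j)) else 0) +
  (if nat_of_ord j == y.+1 then v * (F (prop1 j - n%:R^-1) - F (prop1 j)) else 0)));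
  last first.
  move=> y yj; rewrite /jump_rate.
  have [yE|_] := eqVneq (nat_of_ord y) j.+1.
    rewrite [in X in _ = _ + X]ifF ?addr0; last by apply/eqP; lia.
    congr (_ * (F _ - _)).
    by rewrite /prop1 yE addnS -natr1 mulrDl mul1r.
  have [jE|_] := eqVneq (nat_of_ord j) y.+1; last by rewrite mul0r addr0.
  rewrite add0r; congr (_ * (F _ - _)).
  by rewrite /prop1 jE addnS -natr1 mulrDl mul1r addrK.
rewrite big_split/= -!big_mkcondr/=; congr (_ + _).
  have [jm|jm] := boolP (j.+1 < (n - stubborn n g0 - stubborn n g1).+1)%N.
    rewrite (big_pred1 (Ordinal jm))// => y.
    apply/andP/eqP => [[_ /eqP H]|->]; first exact: val_inj.
    by split=> //; apply/eqP => /(congr1 (@nat_of_ord _)) /= /eqP; rewrite gtn_eqF.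
  rewrite big_pred0 => [|y]; last first.
    rewrite andbC; apply/negP => /andP[/eqP H _]; move: jm.
    by rewrite -H ltn_ord.
  rewrite /u /rate_up (_ : 1 - _ - _ = 0) ?mulr0 ?mul0r//.
  have -> : prop1 j = 1 - (stubborn n g0)%:R / n%:R.
    apply/(mulIf n0R); rewrite /prop1 mulrBl mul1r !divfK//.
    apply/eqP; rewrite eq_sym subr_eq -natrD eqr_nat.
    have := ltn_ord j; move: jm ne; rewrite /nonempty_states.
    by move: (stubborn _ _) (stubborn _ _) (nat_of_ord j) => a b c; lia.
  by ring.
have [j0|j0] := posnP j.
  rewrite big_pred0 => [|y]; last by rewrite j0 andbF.
  rewrite /v /rate_down /prop1 j0 addn0 subrr.
  by rewrite mulr0 !mul0r.
have jm : (j.-1 < (n - stubborn n g0 - stubborn n g1).+1)%N.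
  by apply: leq_ltn_trans (ltn_ord j); exact: leq_pred.
rewrite (big_pred1 (Ordinal jm))// => y.
apply/andP/eqP => [[_ /eqP H]|->]; first by apply: val_inj; rewrite /= H.
split; last by rewrite /= prednK.
by apply/eqP => /(congr1 (@nat_of_ord _)) /= /eqP; rewrite ltn_eqF// prednK.
Qed.

End Rates.

(** * Exponential barriers *)

Lemma expR_le_quadratic (R : realType) (t : R) : t <= 2^-1 ->
  expR t <= 1 + t + 2 * t ^+ 2.
Proof.
move=> t2; have t1 : 0 < 1 - t by lra.
have H : 1 - t <= expR (- t) by exact: expR_ge1Dx.
rewrite -[t in expR t]opprK expRN.
apply: (@le_trans _ _ (1 - t)^-1); first by rewrite lef_pV2 ?posrE ?expR_gt0.
rewrite -[leLHS]mul1r ler_pdivrMr//.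
have : 0 <= t ^+ 2 * (1 - 2 * t) by rewrite mulr_ge0 ?sqr_ge0//; lra.
by nra.
Qed.

Lemma near_natr_expR_le (R : realType) (C beta e : R) : 0 <= C -> 0 < beta -> 0 < e ->
  \forall n \near \oo, C * n%:R * expR (- (beta * n%:R)) <= e.
Proof.
move=> C0 b0 e0.
have H1 := nbhs_infty_ger (2 * C / (beta ^+ 2 * e)).
have H2 := nbhs_infty_ger (1 : R).
apply: filterS2 H1 H2 => n; rewrite ler_pdivrMr ?mulr_gt0 ?exprn_gt0// => Hn n1.
have n0 : 0 < n%:R :> R by lra.
rewrite expRN ler_pdivrMr ?expR_gt0//.
have bn0 : 0 <= beta * n%:R by rewrite mulr_ge0 ?ltW.
have /= := expR_ge1Dxn 1 bn0; rewrite (_ : 2`!%:R = 2)// => He.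
have : e * (1 + (beta * n%:R) ^+ 2 / 2) <= e * expR (beta * n%:R).
  by rewrite ler_pM2l.
apply: le_trans.
have : 2 * C * n%:R <= n%:R * (beta ^+ 2 * e) * n%:R by rewrite ler_pM2r.
rewrite exprMn expr2 => ?; rewrite mulrDr mulr1.
have -> : e * (beta * beta * n%:R ^+ 2 / 2) = n%:R * (beta * beta * e) * n%:R / 2.
  by rewrite expr2; ring.
by lra.
Qed.

Lemma generatorD (R : realType) (T : finType) (q : T -> T -> R) (f g : T -> R) x :
  generator q (fun y => f y + g y) x = generator q f x + generator q g x.
Proof. by rewrite /generator -big_split; apply: eq_bigr => y _ /=; ring. Qed.

Lemma sqr_eq1_cases (R : realType) (s : R) : s * s = 1 -> s = 1 \/ s = -1.
Proof.
by move/eqP; rewrite -expr2 sqrf_eq1 => /orP[] /eqP ->; [left|right].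
Qed.

Lemma normr_sign_root (R : realType) (s : R) : s * s = 1 -> `|s| = 1.
Proof. by move=> /sqr_eq1_cases[] ->; rewrite ?normrN normr1. Qed.

Section Barrier.
Context (R : realType) (k : nat) (g0 g1 K : R).

(** The conclusion of [rates_drift] for a given constant. *)
Definition rates_near_drift : Prop :=
  forall n (j : state g0 g1 n), (2 <= n)%N -> nonempty_states g0 g1 n ->
    exists a b, [/\ rate_up k g0 n (prop1 j) = n%:R * a,
      rate_down k g1 n (prop1 j) = n%:R * b, 0 <= a <= K, 0 <= b <= K &
      `|a - b - (drift k g0 g1).[prop1 j]| <= K / n%:R].

(** For [s] equal to plus or minus one, a function of the proportion that is
exponentially large in [n] on one side of the threshold [c]. *)
Definition barrier (alpha : R) (n : nat) (s c x : R) : R :=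
  expR (alpha * n%:R * (s * x - c)).

Lemma barrier_step alpha n s c x e : (0 < n)%N ->
  barrier alpha n s c (x + e * n%:R^-1) = barrier alpha n s c x * expR (alpha * s * e).
Proof.
move=> n0; rewrite /barrier -expRD; congr expR.
by field; rewrite pnatr_eq0 -lt0n.
Qed.

Hypothesis K1 : 1 <= K.
Hypothesis HK : rates_near_drift.

Lemma generator_barrier_le alpha n s c (j : state g0 g1 n) a b :
    0 < alpha <= 2^-1 -> s * s = 1 -> (2 <= n)%N -> nonempty_states g0 g1 n ->
    rate_up k g0 n (prop1 j) = n%:R * a ->
    rate_down k g1 n (prop1 j) = n%:R * b ->
    0 <= a <= K -> 0 <= b <= K ->
  generator (@jump_rate R k g0 g1 n) (fun i => barrier alpha n s c (prop1 i)) j <=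
  n%:R * barrier alpha n s c (prop1 j) * (alpha * (s * (a - b)) + 4 * K * alpha ^+ 2).
Proof.
move=> /andP[al0 al2] ss n2 ne Ea Eb /andP[a0 aK] /andP[b0 bK].
have n0 : (0 < n)%N by rewrite (leq_trans _ n2).
rewrite (@generator_prop1 _ k _ _ n (barrier alpha n s c))// Ea Eb.
have := barrier_step alpha s c (prop1 j) 1 n0.
rewrite mul1r mulr1 => ->.
have := barrier_step alpha s c (prop1 j) (-1) n0.
rewrite mulN1r mulrN1 => ->.
set B := barrier _ _ _ _ _.
have B0 : 0 <= n%:R * B by rewrite mulr_ge0// expR_ge0.
have ss1 := sqr_eq1_cases ss.
have q1 : expR (alpha * s) - 1 <= alpha * s + 2 * alpha ^+ 2.
  have : expR (alpha * s) <= 1 + alpha * s + 2 * (alpha * s) ^+ 2.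
    by apply: expR_le_quadratic; case: ss1 => ->; lra.
  by rewrite exprMn [s ^+ 2]expr2 ss mulr1; lra.
have q2 : expR (- (alpha * s)) - 1 <= - (alpha * s) + 2 * alpha ^+ 2.
  have : expR (- (alpha * s)) <= 1 + - (alpha * s) + 2 * (- (alpha * s)) ^+ 2.
    by apply: expR_le_quadratic; case: ss1 => ->; lra.
  by rewrite sqrrN exprMn [s ^+ 2]expr2 ss mulr1; lra.
rewrite (_ : _ + _ = n%:R * B *
  (a * (expR (alpha * s) - 1) + b * (expR (- (alpha * s)) - 1))); last by ring.
apply: ler_wpM2l => //.
have h1 : a * (expR (alpha * s) - 1) <= a * (alpha * s + 2 * alpha ^+ 2).
  by rewrite ler_wpM2l.
have h2 : b * (expR (- (alpha * s)) - 1) <= b * (- (alpha * s) + 2 * alpha ^+ 2).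
  by rewrite ler_wpM2l.
have h3 : (a + b) * alpha ^+ 2 <= (2 * K) * alpha ^+ 2.
  by rewrite ler_wpM2r ?sqr_ge0//; lra.
by move: h1 h2 h3; nra.
Qed.

Lemma generator_barrier_bounded alpha n s c (j : state g0 g1 n) :
    0 < alpha <= 2^-1 -> s * s = 1 -> (2 <= n)%N -> nonempty_states g0 g1 n ->
  generator (@jump_rate R k g0 g1 n) (fun i => barrier alpha n s c (prop1 i)) j <=
  2 * K * n%:R * barrier alpha n s c (prop1 j).
Proof.
move=> al ss n2 ne; have [a [b [Ea Eb aK bK _]]] := HK j n2 ne.
apply: le_trans (generator_barrier_le c al ss n2 ne Ea Eb aK bK) _.
have B0 : 0 <= n%:R * barrier alpha n s c (prop1 j) by rewrite mulr_ge0// expR_ge0.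
have KK := K1.
rewrite -[leRHS]mulrA mulrC ler_wpM2r//.
case/andP: al => al0 al2; case/andP: aK => a0 aK; case/andP: bK => b0 bK.
have : s * (a - b) <= K.
  apply: le_trans (ler_norm _) _; rewrite normrM.
  by rewrite (normr_sign_root ss) mul1r ler_norml; apply/andP; split; lra.
move=> h0; have h1 : alpha * (s * (a - b)) <= alpha * K by rewrite ler_pM2l.
have h2 : alpha * K <= 2^-1 * K by rewrite ler_wpM2r//; lra.
have h3 : K * alpha ^+ 2 <= K * (1 / 4).
  by rewrite ler_wpM2l//; [lra|rewrite expr2; nra].
by move: h1 h2 h3; lra.
Qed.

(** For large [n] the difference of the rate coefficients inherits the sign of
the drift, with half of its lower bound. *)
Lemma drift_coefficient n m s (j : state g0 g1 n) a b :
    s * s = 1 -> (2 <= n)%N -> 2 * K <= m * n%:R ->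
    `|a - b - (drift k g0 g1).[prop1 j]| <= K / n%:R ->
    s * (drift k g0 g1).[prop1 j] <= - m ->
  s * (a - b) <= - (m / 2).
Proof.
move=> ss n2 nm H sD.
have n0 : 0 < n%:R :> R by rewrite ltr0n (leq_trans _ n2).
have h1 : K / n%:R <= m / 2 by rewrite ler_pdivrMr//; lra.
have h2 : s * (a - b - (drift k g0 g1).[prop1 j]) <= K / n%:R.
  apply: le_trans (ler_norm _) _; rewrite normrM.
  by rewrite (normr_sign_root ss) mul1r.
by move: h1 h2 sD; rewrite mulrBr; lra.
Qed.

Lemma generator_barrier_le0 alpha m n s c (j : state g0 g1 n) :
    0 < alpha <= 2^-1 -> 8 * K * alpha <= m -> s * s = 1 -> (2 <= n)%N ->
    nonempty_states g0 g1 n -> 2 * K <= m * n%:R ->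
    s * (drift k g0 g1).[prop1 j] <= - m ->
  generator (@jump_rate R k g0 g1 n) (fun i => barrier alpha n s c (prop1 i)) j <= 0.
Proof.
move=> al alm ss n2 ne nm sD; have [a [b [Ea Eb aK bK Hab]]] := HK j n2 ne.
apply: le_trans (generator_barrier_le c al ss n2 ne Ea Eb aK bK) _.
have B0 : 0 <= n%:R * barrier alpha n s c (prop1 j) by rewrite mulr_ge0// expR_ge0.
apply: mulr_ge0_le0 => //.
have h1 := drift_coefficient ss n2 nm Hab sD.
case/andP: al => al0 al2.
have : alpha * (s * (a - b)) <= alpha * - (m / 2) by rewrite ler_pM2l.
have : 8 * K * alpha * alpha <= m * alpha by rewrite ler_pM2r.
by rewrite expr2; lra.
Qed.

(** The distance to [r] decreases on average at a positive rate wherever the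
drift points to [r]. *)
Lemma generator_distance_le kappa m n s (j : state g0 g1 n) r :
    0 <= kappa -> s * s = 1 -> (2 <= n)%N ->
    nonempty_states g0 g1 n -> 2 * K <= m * n%:R ->
    n%:R^-1 <= s * (prop1 j - r) ->
    s * (drift k g0 g1).[prop1 j] <= - m ->
  generator (@jump_rate R k g0 g1 n) (fun i => kappa * `|prop1 i - r|) j <=
    - (kappa * m / 2).
Proof.
move=> k0 ss n2 ne nm jr sD; have [a [b [Ea Eb aK bK Hab]]] := HK j n2 ne.
have n0 : (0 < n)%N by rewrite (leq_trans _ n2).
have n0R : 0 < n%:R :> R by rewrite ltr0n.
rewrite (@generator_prop1 _ k _ _ n (fun x => kappa * `|x - r|))// Ea Eb.
have h1 := drift_coefficient ss n2 nm Hab sD.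
have ni : 0 < n%:R^-1 :> R by rewrite invr_gt0.
have nn : n%:R * n%:R^-1 = 1 :> R by rewrite divff// gt_eqF.
have norm_s x : 0 <= s * x -> `|x| = s * x.
  move=> sx; rewrite -(ger0_norm sx) normrM.
  by rewrite (normr_sign_root ss) mul1r.
have ss1 := sqr_eq1_cases ss.
rewrite !norm_s; last 3 first.
- by case: ss1 jr => -> ?; lra.
- by case: ss1 jr => -> ?; lra.
- by case: ss1 jr => -> ?; lra.
have -> : n%:R * a * (kappa * (s * (prop1 j + n%:R^-1 - r)) - kappa * (s * (prop1 j - r))) +
  n%:R * b * (kappa * (s * (prop1 j - n%:R^-1 - r)) - kappa * (s * (prop1 j - r))) =
  (n%:R * n%:R^-1) * (kappa * (s * (a - b))) by ring.
rewrite nn mul1r -mulrA -mulrN ler_wpM2l//.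
Qed.

End Barrier.

Lemma start_state_near (R : realType) (g0 g1 p : R) n : Gamma g0 g1 ->
    Sspace g0 g1 p -> (0 < n)%N -> nonempty_states g0 g1 n ->
  `|prop1 (start_state g0 g1 n p) - p| <= n%:R^-1.
Proof.
move=> [/andP[h0 _] /andP[h1 _] _] /andP[p0 p1] n0 ne.
have n0R : 0 < n%:R :> R by rewrite ltr0n.
have np0 : 0 <= n%:R * p by rewrite mulr_ge0//; lra.
have /andP[c0 c1] := natr_absz_ceil np0.
have /andP[s0 s0'] := stubborn_bounds n (ltW h0).
have N1c : (stubborn n g1 <= `|Num.ceil (n%:R * p)|)%N.
  rewrite /stubborn -lez_nat !gez0_abs ?ceil_ge0.
  - by apply: le_ceil; rewrite ler_pM2l.
  - by rewrite (lt_le_trans _ np0)// ltrN10.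
  - by rewrite (@lt_le_trans _ _ 0) ?ltrN10// mulr_ge0// ltW.
rewrite /prop1 /start_state inordK; last first.
  by rewrite ltnS leq_sub2r// geq_minr.
rewrite subnKC; last by rewrite leq_min N1c/=; move: ne; rewrite /nonempty_states; lia.
set c := `|_|%N in c0 c1 N1c *; set N0 := stubborn n g0 in s0 s0' ne *.
have N0n : (N0 <= n)%N by move: ne; rewrite /nonempty_states; lia.
have -> : (minn c (n - N0))%:R / n%:R - p =
  ((minn c (n - N0))%:R - n%:R * p) / n%:R by field; rewrite gt_eqF.
rewrite normrM (gtr0_norm (x := n%:R^-1)) ?invr_gt0//.
rewrite -[leRHS]mul1r ler_pM2r ?invr_gt0//.
have : (minn c (n - N0))%:R <= c%:R :> R by rewrite ler_nat geq_minl.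
have : n%:R * p <= n%:R * (1 - g0) by rewrite ler_pM2l.
rewrite mulrBr mulr1 => ?.
rewrite ler_norml => ?; apply/andP; split; last by lra.
by rewrite /minn; case: ifP => _; rewrite ?natrB//; lra.
Qed.

(** * Metastability and entrance times *)

Section Wells.
Context (R : realType) (k : nat) (g0 g1 r1 rm r2 : R).
Hypothesis k1 : (1 <= k)%N.
Hypothesis hG : Gamma_sub k g0 g1.
Hypothesis r1m : r1 < rm.
Hypothesis rm2 : rm < r2.
Hypothesis hroots : drift_roots k g0 g1 [:: r1; rm; r2].
(** The states whose proportion lies in the ball. *)
Definition ball_states (r delta : R) (n : nat) : {set state g0 g1 n} :=
  [set y | `[< ball r delta (prop1 y) >]]%SET.

(** Whatever the realization of the chain with [n] agents, when started in the
ball of half the radius it stays in the ball up to time [t] with probability at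
least [1 - e]. *)
Definition retention (r delta t e : R) (n : nat) : Prop :=
  forall (d : measure_display) (Omega : measurableType d)
    (Pr : state g0 g1 n -> probability Omega R) (X : R -> Omega -> state g0 g1 n),
  is_markov_chain (@jump_rate R k g0 g1 n) Pr X ->
  forall x : state g0 g1 n, ball r (delta / 2) (prop1 x) ->
  1 - e <= fine (Pr x (stays_upto X t (ball_states r delta n))).

(** Wells are metastable on an exponential time scale. *)
Lemma metastable r s delta : is_well r1 r2 r s -> 0 < delta ->
    2 * delta <= s * (r - rm) ->
  exists2 c : R, 0 < c & forall e : R, 0 < e -> \forall n \near \oo,
    retention r delta (expR (c * n%:R)) e n.
Proof.
move=> rs d0 drm.
have hG' : Gamma g0 g1 by case: hG.
have [/andP[/ltW h0 _] /andP[/ltW h1 _] _] := hG'.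
have ss := is_well_sqr rs.
have [|m m0 Hm] := @drift_sign _ k g0 g1 r1 rm r2 k1 hG r1m rm2 hroots r s (delta / 4) rs.
  by lra.
have [K K1 HK] := @rates_drift R k g0 g1 hG'.
pose alpha := Num.min 2^-1 (m / (8 * K)).
have al0 : 0 < alpha by rewrite lt_min invr_gt0 ltr0n/= divr_gt0//; lra.
have al2 : alpha <= 2^-1 by rewrite ge_min lexx.
have alm : 8 * K * alpha <= m.
  have : alpha <= m / (8 * K) by rewrite ge_min lexx orbT.
  by rewrite ler_pdivlMr 1?mulrC//; lra.
have al : 0 < alpha <= 2^-1 by rewrite al0.
have ad0 : 0 < alpha * delta by rewrite mulr_gt0.
exists (alpha * delta / 4); first by lra.
move=> e e0.
have N1 := near_nonempty_states hG'.
have N2 := nbhs_infty_ger (2 : R).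
have N3 := nbhs_infty_ger (2 * K / m).
have b0 : 0 < alpha * delta / 2 by lra.
have C0 : 0 <= 7 * K by lra.
have N4 := near_natr_expR_le C0 b0 e0.
near=> n.
have ne : nonempty_states g0 g1 n by near: n.
have n2R : 2 <= n%:R :> R by near: n.
have n2 : (2 <= n)%N by rewrite -(ler_nat R).
have nm : 2 * K <= m * n%:R.
  by rewrite [m * _]mulrC -ler_pdivrMr//; near: n.
have small : 7 * K * n%:R * expR (- (alpha * delta / 2 * n%:R)) <= e by near: n.
have n0 : (0 < n)%N by rewrite (leq_trans _ n2).
have n0R : 0 < n%:R :> R by rewrite ltr0n.
have an0 : 0 < alpha * n%:R by rewrite mulr_gt0.
move=> d Omega Pr X HX x; rewrite /ball/= ltr_distlC => /andP[rx1 rx2].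
pose V (i : state g0 g1 n) :=
  barrier alpha n 1 (r + delta) (prop1 i) + barrier alpha n (-1) (- r + delta) (prop1 i).
(* a bound for the generator of [V] on the ball that stays exponentially small
   after multiplication by the time horizon [expR (alpha * delta / 4 * n)] *)
pose kappa := 5 * K * n%:R * expR (- (alpha * delta * 3 / 4 * n%:R)).
have k0 : 0 < kappa by rewrite !mulr_gt0 ?expR_gt0//; lra.
have Vx : V x <= 2 * expR (- (alpha * delta / 2 * n%:R)).
  have : barrier alpha n 1 (r + delta) (prop1 x) <= expR (- (alpha * delta / 2 * n%:R)).
    rewrite /barrier ler_expR (_ : - _ = alpha * n%:R * (- (delta / 2))); last by ring.
    by rewrite ler_pM2l//; lra.
  have : barrier alpha n (-1) (- r + delta) (prop1 x) <= expR (- (alpha * delta / 2 * n%:R)).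
    rewrite /barrier ler_expR (_ : - _ = alpha * n%:R * (- (delta / 2))); last by ring.
    by rewrite ler_pM2l//; lra.
  by rewrite /V; lra.
apply: le_trans (@stays_upto_ge _ _ _ _ _ _ _ HX (expR (alpha * delta / 4 * n%:R))
  (ball_states r delta n) V kappa x _ _ _ _ _).
- have -> : kappa * expR (alpha * delta / 4 * n%:R) =
      5 * K * n%:R * expR (- (alpha * delta / 2 * n%:R)).
    by rewrite /kappa -mulrA -expRD; congr (_ * expR _); field.
  have : 2 * expR (- (alpha * delta / 2 * n%:R)) <=
         2 * K * n%:R * expR (- (alpha * delta / 2 * n%:R)).
    by rewrite ler_wpM2r ?expR_ge0//; nra.
  by lra.
- exact: expR_gt0.
- exact: ltW.
- by move=> y; rewrite /V addr_ge0// expR_ge0.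
- move=> y; rewrite inE => /asboolPn; rewrite /ball/= => /negP.
  rewrite -leNgt ler_normr => H.
  have : 0 <= barrier alpha n 1 (r + delta) (prop1 y) by exact: expR_ge0.
  have : 0 <= barrier alpha n (-1) (- r + delta) (prop1 y) by exact: expR_ge0.
  have exp1 t : 0 <= t -> 1 <= expR (alpha * n%:R * t).
    by move=> t0; rewrite -[leLHS]expR0 ler_expR mulr_ge0// ltW.
  case/orP: H => H.
    have : 1 <= barrier alpha n (-1) (- r + delta) (prop1 y) by apply: exp1; lra.
    by rewrite /V; lra.
  have : 1 <= barrier alpha n 1 (r + delta) (prop1 y) by apply: exp1; lra.
  by rewrite /V; lra.
move=> y; rewrite inE => /asboolP; rewrite /ball/= ltr_distlC => /andP[ry1 ry2].
have Sy := prop1_S y h0 h1 n0 ne.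
have [|ml mr] := Hm _ Sy.
  have : s * (r - rm) - delta <= s * (prop1 y - rm).
    by case: (sqr_eq1_cases ss) => ->; lra.
  by lra.
rewrite generatorD.
(* each exponential either does not increase on average, or is tiny since its
   threshold is at distance at least [3 delta / 4] *)
have part sg c : sg * sg = 1 ->
    (sg * (drift k g0 g1).[prop1 y] <= - m \/
     sg * prop1 y - c <= - (delta * 3 / 4)) ->
    generator (@jump_rate R k g0 g1 n) (fun i => barrier alpha n sg c (prop1 i)) y <=
    2 * K * n%:R * expR (- (alpha * delta * 3 / 4 * n%:R)).
  move=> sgg [H|H].
    apply: le_trans (generator_barrier_le0 HK c al alm sgg n2 ne nm H) _.
    by rewrite mulr_ge0 ?expR_ge0// mulr_ge0//; lra.
  apply: le_trans (generator_barrier_bounded K1 HK c y al sgg n2 ne) _.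
  rewrite ler_wpM2l//; first by rewrite mulr_ge0//; lra.
  rewrite /barrier ler_expR (_ : - _ = alpha * n%:R * - (delta * 3 / 4)); last by field.
  by rewrite ler_pM2l.
have p1 : generator (@jump_rate R k g0 g1 n)
     (fun i => barrier alpha n 1 (r + delta) (prop1 i)) y <=
    2 * K * n%:R * expR (- (alpha * delta * 3 / 4 * n%:R)).
  apply: part; first by rewrite mulr1.
  have [H|H] := leP (r + delta / 4) (prop1 y); [left|right; lra].
  by rewrite mul1r mr.
have p2 : generator (@jump_rate R k g0 g1 n)
     (fun i => barrier alpha n (-1) (- r + delta) (prop1 i)) y <=
    2 * K * n%:R * expR (- (alpha * delta * 3 / 4 * n%:R)).
  apply: part; first by rewrite mulrNN mulr1.
  have [H|H] := leP (prop1 y) (r - delta / 4); [left|right; lra].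
  by rewrite mulN1r lerN2 ml.
have : 0 < K * n%:R * expR (- (alpha * delta * 3 / 4 * n%:R)).
  by rewrite !mulr_gt0 ?expR_gt0//; lra.
by rewrite /kappa; lra.
Unshelve. all: by end_near. Qed.

(** Whatever the realization of the chain with [n] agents, when started near
the proportion [p] it avoids the ball up to time [t] with probability at most
[e]. *)
Definition slow_entrance_le (p r delta t e : R) (n : nat) : Prop :=
  forall (d : measure_display) (Omega : measurableType d)
    (Pr : state g0 g1 n -> probability Omega R) (X : R -> Omega -> state g0 g1 n),
  is_markov_chain (@jump_rate R k g0 g1 n) Pr X ->
  fine (Pr (start_state g0 g1 n p)
    (stays_upto X t [set y | ~~ `[< ball r delta (prop1 y) >]]%SET)) <= e.

(** A chain started on the side of a well reaches any neighbourhood of that well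
in a time that does not grow with [n]. *)
Lemma entrance r s p delta : is_well r1 r2 r s -> Sspace g0 g1 p ->
    0 < s * (p - rm) -> 0 < delta ->
  exists2 C : R, 0 < C & forall e : R, 0 < e -> \forall n \near \oo,
    slow_entrance_le p r delta (C / e) e n.
Proof.
move=> rs Sp sp d0.
have hG' : Gamma g0 g1 by case: hG.
have [/andP[/ltW h0 _] /andP[/ltW h1 _] _] := hG'.
have ss := is_well_sqr rs.
have ss1 := sqr_eq1_cases ss.
have srm : 0 < s * (r - rm) := is_well_gt0 r1m rm2 rs.
have Sr : Sspace g0 g1 r := is_well_S hroots rs.
pose eta := Num.min delta (s * (p - rm) / 2).
have eta0 : 0 < eta by rewrite lt_min d0/=; lra.
have etad : eta <= delta by rewrite ge_min lexx.
have etap : eta <= s * (p - rm) / 2 by rewrite ge_min lexx orbT.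
have [m m0 Hm] := @drift_sign _ k g0 g1 r1 rm r2 k1 hG r1m rm2 hroots r s eta rs eta0.
have [K K1 HK] := @rates_drift R k g0 g1 hG'.
pose alpha := Num.min 2^-1 (m / (8 * K)).
have al0 : 0 < alpha by rewrite lt_min invr_gt0 ltr0n/= divr_gt0//; lra.
have al2 : alpha <= 2^-1 by rewrite ge_min lexx.
have alm : 8 * K * alpha <= m.
  have : alpha <= m / (8 * K) by rewrite ge_min lexx orbT.
  by rewrite ler_pdivlMr 1?mulrC//; lra.
have al : 0 < alpha <= 2^-1 by rewrite al0.
exists (12 / m); first by rewrite divr_gt0.
move=> e e0.
(* the inverse of the time horizon; the distance term of [V] decreases at rate
   [e / 2 * m / 2 = 3 * kappa], which leaves room for the barrier term *)
pose kappa := e * m / 12.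
have kap0 : 0 < kappa by rewrite divr_gt0// mulr_gt0.
have N1 := near_nonempty_states hG'.
have N2 := nbhs_infty_ger (2 : R).
have N3 := nbhs_infty_ger (2 * K / m).
have N3' := nbhs_infty_ger (2 / eta).
have C0 : 0 <= 2 * K by lra.
have b0 : 0 < alpha * (s * (r - rm)) by rewrite mulr_gt0.
have N4 := near_natr_expR_le C0 b0 kap0.
have b0' : 0 < alpha * (eta / 2) by rewrite mulr_gt0// divr_gt0.
have e20 : 0 < e / 2 by lra.
have N5 := near_natr_expR_le (@ler01 R) b0' e20.
near=> n.
have ne : nonempty_states g0 g1 n by near: n.
have n2R : 2 <= n%:R :> R by near: n.
have n2 : (2 <= n)%N by rewrite -(ler_nat R).
have nm : 2 * K <= m * n%:R.
  by rewrite [m * _]mulrC -ler_pdivrMr//; near: n.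
have n0 : (0 < n)%N by rewrite (leq_trans _ n2).
have n0R : 0 < n%:R :> R by rewrite ltr0n.
have neta : n%:R^-1 <= eta / 2.
  rewrite -[leLHS]mul1r ler_pdivrMr// mulrAC ler_pdivlMr// mul1r mulrC.
  by rewrite -ler_pdivrMr//; near: n.
have small1 : 2 * K * n%:R * expR (- (alpha * (s * (r - rm)) * n%:R)) <= kappa.
  by near: n.
have small2 : 1 * n%:R * expR (- (alpha * (eta / 2) * n%:R)) <= e / 2 by near: n.
have an0 : 0 < alpha * n%:R by rewrite mulr_gt0.
move=> d Omega Pr X HX.
pose c := - (s * rm) - eta.
pose V (i : state g0 g1 n) :=
  barrier alpha n (- s) c (prop1 i) + e / 2 * `|prop1 i - r|.
have T0 : 0 < 12 / m / e by rewrite !divr_gt0.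
have kT : kappa * (12 / m / e) = 1.
  by rewrite /kappa; field; rewrite !gt_eqF.
set x := start_state g0 g1 n p.
have xp := start_state_near hG' Sp n0 ne; rewrite -/x in xp.
have Sx := prop1_S x h0 h1 n0 ne.
have Vx : V x <= e.
  have x1 : `|prop1 x - r| <= 1.
    move: Sx Sr => /andP[? ?] /andP[? ?].
    by rewrite ler_norml; apply/andP; split; lra.
  have : e / 2 * `|prop1 x - r| <= e / 2 * 1 by rewrite ler_pM2l.
  have : barrier alpha n (- s) c (prop1 x) <= e / 2.
    apply: le_trans small2; rewrite mul1r.
    apply: (@le_trans _ _ (1 * expR (- (alpha * (eta / 2) * n%:R)))); last first.
      by rewrite ler_wpM2r ?expR_ge0//; lra.
    rewrite mul1r ler_expR.
    rewrite (_ : - (_ * n%:R) = alpha * n%:R * (- (eta / 2))); last by ring.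
    rewrite ler_pM2l// /c.
    have : s * (p - prop1 x) <= n%:R^-1.
      apply: le_trans (ler_norm _) _.
      by rewrite normrM (normr_sign_root ss) mul1r distrC.
    by lra.
  by rewrite /V; lra.
apply: le_trans (@stays_upto_le _ _ _ _ _ _ _ HX (12 / m / e) _ V kappa x _ _ _ _ _) _.
- exact: T0.
- exact: ltW.
- by rewrite kT.
- by move=> y; rewrite /V addr_ge0 ?expR_ge0// mulr_ge0//; lra.
- move=> y; rewrite inE => /asboolPn; rewrite /ball/= => /negP.
  rewrite -leNgt distrC => Hd.
  have Sy := prop1_S y h0 h1 n0 ne.
  have B0 : 0 <= barrier alpha n (- s) c (prop1 y) by exact: expR_ge0.
  have [Hs|Hs] := ltP (s * (prop1 y - rm)) eta.
    left; rewrite /V.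
    have : 1 <= barrier alpha n (- s) c (prop1 y).
      rewrite -[leLHS]expR0 ler_expR mulr_ge0//; first exact: ltW.
      by rewrite /c; lra.
    have : 0 <= e / 2 * `|prop1 y - r| by rewrite mulr_ge0//; lra.
    by lra.
  right; have [ml mr] := Hm _ Sy Hs.
  rewrite generatorD.
  have sNs : - s * - s = 1 by rewrite mulrNN.
  have em : e / 2 * m / 2 = 3 * kappa by rewrite /kappa; field.
  have e20' : 0 <= e / 2 by lra.
  have /orP[side|side] : (s * (prop1 y - r) <= - delta) || (delta <= s * (prop1 y - r)).
    rewrite -(mul1r `|_|) -(normr_sign_root ss) -normrM ler_normr in Hd.
    by rewrite orbC; case/orP: Hd => ?; apply/orP; [left|right]; lra.
  (* between the unstable zero and the well, both parts decrease *)
    have sD : - s * (drift k g0 g1).[prop1 y] <= - m.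
      by case: ss1 side ml mr => -> side ml mr;
        [have := ml ltac:(lra)|have := mr ltac:(lra)]; lra.
    have := generator_barrier_le0 HK c al alm sNs n2 ne nm sD.
    have side' : n%:R^-1 <= - s * (prop1 y - r) by lra.
    have := generator_distance_le HK e20' sNs n2 ne nm side' sD.
    by rewrite em; lra.
  (* beyond the well the barrier is exponentially small *)
  have sD : s * (drift k g0 g1).[prop1 y] <= - m.
    by case: ss1 side ml mr => -> side ml mr;
      [have := mr ltac:(lra)|have := ml ltac:(lra)]; lra.
  have side' : n%:R^-1 <= s * (prop1 y - r) by lra.
  have := generator_distance_le HK e20' ss n2 ne nm side' sD.
  have := generator_barrier_bounded K1 HK c y al sNs n2 ne.
  have : 2 * K * n%:R * barrier alpha n (- s) c (prop1 y) <= kappa.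
    apply: le_trans small1; rewrite ler_wpM2l//; first by rewrite mulr_ge0//; lra.
    rewrite /barrier ler_expR.
    rewrite (_ : - (_ * n%:R) = alpha * n%:R * (- (s * (r - rm)))); last by ring.
    by rewrite ler_pM2l// /c; lra.
  by rewrite em; lra.
by rewrite kT; lra.
Unshelve. all: by end_near. Qed.

End Wells.

Lemma bigOmega_ge (R : realType) (f : nat -> \bar R) (g : nat -> R) :
    (forall n, 0 < g n) -> (\forall n \near \oo, ((g n)%:E <= f n)%E) ->
  Defs.bigOmega f g.
Proof.
move=> g0 [N _ HN]; apply: (@le_lt_trans _ _ 1%E); last exact: ltry.
apply: ge_ereal_inf.
exists (ereal_sup [set ((g n)%:E / f n)%E | n in [set n | (N <= n)%N]]).
  by exists [set n | (N <= n)%N] => //; exists N.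
apply: ge_ereal_sup => _ [n /= Nn <-].
have := HN n Nn; case: (f n) => [r| |] /=.
- rewrite lee_fin => gr; have r0 : 0 < r by apply: lt_le_trans gr.
  by rewrite inver gt_eqF// -EFinM lee_fin ler_pdivrMr// mul1r.
- by rewrite invey mule0.
- by [].
Qed.

(** If a set of stationary mass at most one half retains the chain up to time
[t] with a probability above [3/4], the chain has not mixed by time [t]. *)
Lemma mixing_time_ge (R : realType) (T : finType) (q : T -> T -> R)
    (d : measure_display) (Omega : measurableType d)
    (Pr : T -> probability Omega R) (X : R -> Omega -> T) (mu : T -> R)
    (x : T) (A : {set T}) (t : R) : is_markov_chain q Pr X ->
    0 <= t -> \sum_(y in A) mu y <= 2^-1 ->
    3 / 4 < fine (Pr x (stays_upto X t A)) ->
  (t%:E <= mixing_time Pr X mu)%E.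
Proof.
move=> HX t0 muA stay; apply: le_ereal_inf_tmp => _ [s [s0 tv] <-].
rewrite lee_fin leNgt; apply/negP => st.
have : 1 / 4 < tv_distance Pr X mu s; last by rewrite ltNge tv.
apply: (@lt_le_trans _ _ `|fine (Pr x [set w | X s w \in A]) - \sum_(y in A) mu y|).
  apply: lt_le_trans (ler_norm _).
  have : fine (Pr x (stays_upto X t A)) <= fine (Pr x [set w | X s w \in A]).
    have m1 := measurable_stays_upto HX A t0.
    have m2 := measurable_mem HX A s0.
    apply: fine_le; rewrite ?fin_num_measure//.
    apply: le_measure; rewrite ?inE// => w; apply.
    by rewrite s0 ltW.
  by lra.
rewrite /tv_distance; apply: le_trans (le_bigmax _ _ x).
exact: (le_bigmax _ (fun A : {set T} =>
  `|fine (Pr x [set w | X s w \in A]) - \sum_(y in A) mu y|) A).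
Qed.

Theorem theorem5 (R : realType) (k : nat) (hk : (1 <= k)%N) (g0 g1 : R)
    (hG : Gamma_sub k g0 g1)
    (r1 rm r2 : R) (hr1m : r1 < rm) (hrm2 : rm < r2)
    (hroots : drift_roots k g0 g1 [:: r1; rm; r2])
    (d : nat -> measure_display) (Omega : forall n, measurableType (d n))
    (Pr : forall n, state g0 g1 n -> probability (Omega n) R)
    (X : forall n, R -> Omega n -> state g0 g1 n)
    (hX : forall n, nonempty_states g0 g1 n ->
       is_markov_chain (@jump_rate R k g0 g1 n) (Pr n) (X n))
    (mu : forall n, state g0 g1 n -> R)
    (hmu : forall n, nonempty_states g0 g1 n ->
       stationary (Pr n) (X n) (mu n)) :
  [/\ exponentially_large (fun n => mixing_time (Pr n) (X n) (mu n)),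
      forall p : R, Sspace g0 g1 p -> p != rm ->
        exists2 eta : R, 0 < eta &
        forall delta epsilon : R, 0 < delta < eta -> 0 < epsilon < eta ->
        exists2 C : R, 0 < C &
        \forall n \near \oo,
          (Pr n (start_state g0 g1 n p)
             [set w | (C * ln n%:R / epsilon)%:E
                < T_enter (fun t => prop1 (X n t w))
                    (ball (if (p < rm)%R then r1 else r2) delta)]
           <= epsilon%:E)%E
    & forall r : R, r = r1 \/ r = r2 ->
        exists2 eta : R, 0 < eta &
        forall delta : R, 0 < delta < eta ->
        exists c c' : R, [/\ 0 < c, 0 < c' &
        forall x : (forall n, state g0 g1 n),
          (\forall n \near \oo, ball r (delta / 2) (prop1 (x n))) ->
          Pr n (x n)
            [set w | ((c' * expR (c * n%:R))%:E
               <= T_exit (fun t => prop1 (X n t w)) (ball r delta))%E]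
          @[n --> \oo] --> 1%E]].
Proof.
have [hG' _] := hG.
have [/andP[h0 _] /andP[h1 _] _] := hG'.
have well1 : is_well r1 r2 r1 (-1) by left.
have well2 : is_well r1 r2 r2 1 by right.
split.
- (* both wells are metastable, and one of them has stationary mass at most
     one half *)
  (* this radius keeps the two balls on either side of [rm], hence disjoint *)
  pose delta := Num.min (rm - r1) (r2 - rm) / 2.
  have d0 : 0 < delta by rewrite divr_gt0// lt_min !subr_gt0 hr1m.
  have d1 : 2 * delta <= rm - r1.
    by rewrite /delta mulrC divfK// ge_min lexx.
  have d2 : 2 * delta <= r2 - rm.
    by rewrite /delta mulrC divfK// ge_min lexx orbT.
  have [|c1 c10 M1] := metastable hk hG hr1m hrm2 hroots well1 d0; first by lra.
  have [|c2 c20 M2] := metastable hk hG hr1m hrm2 hroots well2 d0; first by lra.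
  pose c := Num.min c1 c2.
  have c0 : 0 < c by rewrite lt_min c10.
  exists c => //; apply: bigOmega_ge => [n|]; first exact: expR_gt0.
  have N1 := near_nonempty_states hG'.
  have N2 := nbhs_infty_ger (1 : R).
  have N3 := nbhs_infty_ger (4 / delta).
  have e8 : 0 < 8^-1 :> R by rewrite invr_gt0.
  have N4 := M1 _ e8.
  have N5 := M2 _ e8.
  near=> n.
  have ne : nonempty_states g0 g1 n by near: n.
  have n1 : 1 <= n%:R :> R by near: n.
  have n0 : (0 < n)%N by rewrite -(ler_nat R).
  have n0R : 0 < n%:R :> R by rewrite ltr0n.
  have nd : n%:R^-1 <= delta / 4.
    rewrite -[leLHS]mul1r ler_pdivrMr// mulrAC ler_pdivlMr// mul1r mulrC.
    by rewrite -ler_pdivrMr//; near: n.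
  have close r s : is_well r1 r2 r s ->
      ball r (delta / 2) (prop1 (start_state g0 g1 n r)).
    move=> rs; rewrite /ball/= distrC.
    have Sr := is_well_S hroots rs.
    by apply: le_lt_trans (start_state_near hG' Sr n0 ne) _; lra.
  have HX := hX n ne.
  have [mu0 mu1 _] := hmu n ne.
  have shrink r c' : c <= c' ->
      1 - 8^-1 <= fine (Pr n (start_state g0 g1 n r)
        (stays_upto (X n) (expR (c' * n%:R)) (ball_states g0 g1 r delta n))) ->
      3 / 4 < fine (Pr n (start_state g0 g1 n r)
        (stays_upto (X n) (expR (c * n%:R)) (ball_states g0 g1 r delta n))).
    move=> cc' H.
    have m1 := measurable_stays_upto HX (ball_states g0 g1 r delta n) (expR_ge0 (c * n%:R)).
    have m2 := measurable_stays_upto HX (ball_states g0 g1 r delta n) (expR_ge0 (c' * n%:R)).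
    apply: (@lt_le_trans _ _ (1 - 8^-1)); first by lra.
    apply: le_trans H _; apply: fine_le; rewrite ?fin_num_measure//.
    apply: le_measure; rewrite ?inE// => w Hw t /andP[t0 tc]; apply: Hw.
    by rewrite t0 (le_trans tc)// ler_expR ler_pM2r.
  have S1 : 3 / 4 < fine (Pr n (start_state g0 g1 n r1)
        (stays_upto (X n) (expR (c * n%:R)) (ball_states g0 g1 r1 delta n))).
    apply: (@shrink _ c1); first by rewrite ge_min lexx.
    have H : retention k g0 g1 r1 delta (expR (c1 * n%:R)) (8^-1) n by near: n.
    by apply: H => //; exact: close well1.
  have S2 : 3 / 4 < fine (Pr n (start_state g0 g1 n r2)
        (stays_upto (X n) (expR (c * n%:R)) (ball_states g0 g1 r2 delta n))).
    apply: (@shrink _ c2); first by rewrite ge_min lexx orbT.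
    have H : retention k g0 g1 r2 delta (expR (c2 * n%:R)) (8^-1) n by near: n.
    by apply: H => //; exact: close well2.
  have mass : \sum_(y in ball_states g0 g1 r1 delta n) mu n y +
              \sum_(y in ball_states g0 g1 r2 delta n) mu n y <= 1.
    rewrite -mu1 [leRHS](bigID (mem (ball_states g0 g1 r1 delta n)))/= lerD2l.
    rewrite big_mkcond [leRHS]big_mkcond/=; apply: ler_sum => y _.
    case: ifP => y2; last by case: ifP.
    have mem_ball r : y \in ball_states g0 g1 r delta n ->
        r - delta < prop1 y < r + delta.
      by rewrite inE => /asboolP; rewrite /ball/= ltr_distlC.
    rewrite ifT//; apply/negP => /mem_ball/andP[? ?].
    by have /andP[? ?] := mem_ball _ y2; lra.
  have [m1|m1] := leP (\sum_(y in ball_states g0 g1 r1 delta n) mu n y) 2^-1.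
    exact: mixing_time_ge HX (expR_ge0 _) m1 S1.
  apply: mixing_time_ge HX (expR_ge0 _) _ S2.
  by move: mass m1; lra.
- move=> p Sp prm; exists 1 => // delta epsilon /andP[d0 _] /andP[e0 _].
  set r := if _ then _ else _.
  have [s rs sp] : exists2 s, is_well r1 r2 r s & 0 < s * (p - rm).
    rewrite /r; case: ltP => prm'; first by exists (-1) => //; lra.
    by exists 1 => //; rewrite mul1r subr_gt0 lt_neqAle eq_sym prm.
  have [C C0 HC] := entrance hk hG hr1m hrm2 hroots rs Sp sp d0.
  exists C => //.
  have N1 := near_nonempty_states hG'.
  have N2 := nbhs_infty_ger (expR 1 : R).
  have N3 := HC _ e0.
  near=> n.
  have ne : nonempty_states g0 g1 n by near: n.
  have n1 : expR 1 <= n%:R :> R by near: n.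
  have H : slow_entrance_le k g0 g1 p r delta (C / epsilon) epsilon n by near: n.
  have HX := hX n ne; have {}H := H _ _ _ _ HX.
  have ln1 : 1 <= ln n%:R :> R.
    by rewrite -[leLHS]expRK ler_ln ?posrE// ?expR_gt0// (lt_le_trans _ n1)// expR_gt0.
  have T0 : 0 <= C / epsilon by rewrite divr_ge0 ?ltW.
  have TT : C / epsilon <= C * ln n%:R / epsilon.
    by rewrite ler_pM2r ?invr_gt0// ler_peMr// ltW.
  have m1 := measurable_T_enter_gt HX (@prop1 R g0 g1 n) (ball r delta) T0.
  have m2 := measurable_T_enter_gt HX (@prop1 R g0 g1 n) (ball r delta) (le_trans T0 TT).
  apply: (@le_trans _ _ (Pr n (start_state g0 g1 n p)
    [set w | ((C / epsilon)%:E < T_enter (fun t => prop1 (X n t w)) (ball r delta))%E])).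
    by apply: le_measure; rewrite ?inE// => w; apply: le_lt_trans; rewrite lee_fin.
  rewrite -lee_fin in H; apply: le_trans H; rewrite fineK.
    by rewrite (T_enter_gtE HX).
  by rewrite fin_num_measure//; exact: (measurable_stays_upto HX).
move=> r Hr.
have [s rs] : exists s, is_well r1 r2 r s.
  by case: Hr => ->; [exists (-1)|exists 1].
have srm := is_well_gt0 hr1m hrm2 rs.
exists (s * (r - rm) / 2); first by lra.
move=> delta /andP[d0 d1].
have [|c c0 M] := metastable hk hG hr1m hrm2 hroots rs d0; first by lra.
exists c, 1; split=> // x xr.
have N1 := near_nonempty_states hG'.
have T0 n : 0 < 1 * expR (c * n%:R) by rewrite mul1r expR_gt0.
apply/fine_cvgP; split.
  near=> n; rewrite fin_num_measure//.
  have ne : nonempty_states g0 g1 n by near: n.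
  exact: (measurable_T_exit_ge (hX n ne)).
apply/cvgrPdist_le => e e0; have N2 := M _ e0.
near=> n.
have ne : nonempty_states g0 g1 n by near: n.
have HX := hX n ne.
have xn : ball r (delta / 2) (prop1 (x n)) by near: n.
have H : retention k g0 g1 r delta (expR (c * n%:R)) e n by near: n.
have {}H := H _ _ _ _ HX _ xn.
have m1 := measurable_T_exit_ge HX (@prop1 R g0 g1 n) (ball r delta) (T0 n).
have m2 := measurable_stays_upto HX (ball_states g0 g1 r delta n) (ltW (T0 n)).
have H1 : fine (Pr n (x n) (stays_upto (X n) (1 * expR (c * n%:R))
    (ball_states g0 g1 r delta n))) <=
  fine (Pr n (x n) [set w | ((1 * expR (c * n%:R))%:E <=
    T_exit (fun t => prop1 (X n t w)) (ball r delta))%E]).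
  apply: fine_le; rewrite ?fin_num_measure//.
  apply: le_measure; rewrite ?inE//.
  exact: (@stays_upto_sub_T_exit _ _ _ _ _ (@prop1 R g0 g1 n) (ball r delta) _ (T0 n)).
have H2 : fine (Pr n (x n) [set w | ((1 * expR (c * n%:R))%:E <=
    T_exit (fun t => prop1 (X n t w)) (ball r delta))%E]) <= 1.
  rewrite -[leRHS](_ : fine 1%E = 1)//.
  by apply: fine_le; rewrite ?fin_num_measure// probability_le1.
rewrite -[expR (c * n%:R)]mul1r in H.
by rewrite /= ger0_norm ?subr_ge0//; move: H H1; lra.
Unshelve. all: by end_near. Qed.
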